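(* Let $T>0$ and let $a\colon[0,T]\to\mathbb{R}$ be a Lebesgue integrable function. Assume that $\{x\in[0,T]\colon a(x)>0\}=\bigcup_{i=1}^{k}J_{i}\neq\emptyset$, where $J_1,\dots,J_k$ are pairwise disjoint nondegenerate intervals. Let $g\colon\mathbb{R}^{+}\to\mathbb{R}^{+}$ be continuously differentiable, with $g(0)=0$ and $g(s)>0$ for all $s>0$, and suppose that \[ \lim_{s\to0^{+}}\frac{g(s)}{s}=0\quad\text{and}\quad \liminf_{s\to+\infty}\frac{g(s)}{s}>\max_{i=1,\dots,k}\lambda_{1}^{i}, \] where $\lambda_1^i$ is the first eigenvalue of the problem $\varphi''+\lambda a(x)\varphi=0$, $\varphi|_{\partial J_i}=0$. If $\int_{0}^{T}a(x)\,dx<0$, then there is at least one positive solution of \[ u''+a(x)g(u)=0\ \text{ on } (0,T),\qquad \mathscr{B}(u,u')=\underline{0}, \] where $\mathscr{B}(u,u')=\underline{0}$ denotes either of the two boundary conditions (Neumann or periodic) described in the context.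
   Context: $\mathbb{R}^{+}=[0,+\infty)$. The boundary operator is either $\mathscr{B}(u,u')=(u'(0),u'(T))$ (Neumann) or $\mathscr{B}(u,u')=(u(T)-u(0),u'(T)-u'(0))$ (periodic); the statement holds for each of the two choices. A solution is a continuously differentiable function $u\colon[0,T]\to\mathbb{R}$ with $u'$ absolutely continuous, satisfying the equation for a.e. $x\in[0,T]$ and the boundary condition. A positive solution is a solution with $u(x)>0$ for every $x\in[0,T]$. The quantity $\liminf_{s\to+\infty}g(s)/s$ may be $+\infty$. *)

(* Defs.v *)
From HB Require Import structures.
From mathcomp Require Import all_boot all_order all_algebra.
From mathcomp Require Import all_classical all_reals all_analysis.

Set Implicit Arguments.
Unset Strict Implicit.
Unset Printing Implicit Defensive.

Import Order.TTheory GRing.Theory Num.Theory.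
Import numFieldNormedType.Exports.

Local Open Scope classical_set_scope.
Local Open Scope ring_scope.

(* Total functions R -> R stand for functions defined on a subset A only, so
   derivatives are taken relative to A; they are one-sided at an endpoint
   belonging to A and ordinary derivatives in the interior of A. *)
Definition has_deriv_in (R : realType) (A : set R) (f : R -> R) (x l : R) :=
  (f y - f x) / (y - x) @[y --> within A x^'] --> l.

Definition C1_in (R : realType) (A : set R) (f f' : R -> R) :=
  (forall x, A x -> has_deriv_in A f x (f' x)) /\ {within A, continuous f'}.

Definition abs_continuous_in (R : realType) (A : set R) (f : R -> R) :=
  forall e : R, 0 < e -> exists2 delta : R, 0 < delta &
    forall (n : nat) (c d : 'I_n -> R),
      (forall i, [/\ A (c i), A (d i) & c i <= d i]) ->
      trivIset [set: 'I_n] (fun i => `]c i, d i[%classic) ->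
      \sum_(i < n) (d i - c i) < delta ->
      \sum_(i < n) `|f (d i) - f (c i)| < e.

(* Caratheodory solutions of u'' + F(x, u) = 0 on the interval A, with u' the
   derivative of u.  The equation holds almost everywhere, so two-sided
   differentiability of u' there is no restriction at the endpoints of A. *)
Definition solves (R : realType) (A : set R) (F : R -> R -> R)
    (u u' : R -> R) :=
  [/\ C1_in A u u',
      abs_continuous_in A u' &
      {ae @completed_lebesgue_measure R, forall x, A x ->
        derivable u' x 1 /\ derive1 u' x + F x (u x) = 0}].

Definition nondegenerate_interval (R : realType) (J : set R) :=
  is_interval J /\ exists x y, [/\ J x, J y & x < y].

Definition dirichlet_eigenvalue (R : realType) (a : R -> R) (J : set R)
    (lam : R) :=
  exists phi phi' : R -> R,
    [/\ solves (closure J) (fun x s => lam * a x * s) phi phi',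
        (forall x, (closure J `\` J°) x -> phi x = 0) &
        exists2 x, closure J x & phi x != 0].

Definition first_eigenvalue (R : realType) (a : R -> R) (J : set R)
    (lam : R) :=
  dirichlet_eigenvalue a J lam /\
  forall mu, dirichlet_eigenvalue a J mu -> lam <= mu.

Variant boundary_type := Neumann | Periodic.

Definition boundary_op (R : realType) (b : boundary_type) (T : R)
    (u u' : R -> R) : R * R :=
  match b with
  | Neumann => (u' 0, u' T)
  | Periodic => (u T - u 0, u' T - u' 0)
  end.

Definition positive_solution (R : realType) (b : boundary_type) (T : R)
    (a g u : R -> R) :=
  (exists u' : R -> R,
    solves `[0, T] (fun x s => a x * g s) u u' /\
    boundary_op b T u u' = (0, 0)) /\
  (forall x, 0 <= x <= T -> 0 < u x).

(* Main.v *)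
(* Existence by shooting, for a nonlinearity f that is globally Lipschitz, vanishes
   on (-oo, 0], agrees with g on [0, R1] and satisfies f(s) >= mu s - C with
   mu > max lambda_i.

   A priori bounds.  If u >= 0 solves u'' + a f(u) = 0, testing the equation on a
   nodal interval of the Dirichlet eigenfunction of J_i, together with the
   concavity of u on J_i, bounds u on J_i by a constant that depends on mu and C
   but not on R1.  Off the J_i the solution is convex, so under either boundary
   condition its maximum is controlled by these bounds; for R1 large the solution
   of the truncated problem therefore solves the original one.

   Existence.  A solution that starts with u(0) >= 0 and reaches 0 afterwards stays
   linear and decreasing, so u(T) <= 0 and u'(T) < 0.  Large initial data force
   such a zero, by the bound on J_1.  For small data and u' vanishing somewhere, u
   is almost constant and u'(T) - u'(0) = - \int a f(u) > 0 because \int a < 0 and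
   f(s) = o(s).  For the Neumann problem the intermediate value theorem applied to
   u(0) |-> u'(T) concludes.  For the periodic problem the pair
   (u(T) - u(0), u'(T) - u'(0)) has a nonzero winding number along the boundary of
   a sector of initial data truncated near 0 and near infinity; Sperner's parity
   argument gives the zero. *)

Require Import Defs.
From HB Require Import structures.
From mathcomp Require Import all_boot all_order all_algebra.
From mathcomp Require Import all_classical all_reals all_analysis.
From mathcomp Require Import measurable_realfun.
From mathcomp Require Import ring lra zify.

Import Order.TTheory GRing.Theory Num.Theory.
Import numFieldNormedType.Exports.

Set Implicit Arguments.
Unset Strict Implicit.

Local Open Scope classical_set_scope.
Local Open Scope ring_scope.

(** * Absolutely continuous functions *)

(** Since [a] is merely integrable, u'' exists only almost everywhere, and no estimate can rest on a
    pointwise second derivative. Everything is drawn from one fact, [ac_nonincreasing]. Each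
    integral estimate (Gronwall, Wronskian, sign of v T - v 0) is obtained by combining the function
    at hand with suitable primitives until its a.e. derivative has a sign; the values at the two
    ends are then compared.

    The truncation level R1 must exceed an a priori bound, while that bound concerns solutions of
    the truncated equation. The circle is broken by making the nodal bound uniform over all f >= 0
    lying above s |-> mu s - C, and by continuing g along a line through the origin of slope at
    least mu.

    Integrability of [a] is given for the completed measure, whereas the primitives are taken for
    the Borel one. A Borel representative equal at every point to [a] or to 0 never becomes negative
    on the J_i, and it is positive nowhere else. *)

Section Cousin.
Context {R : realType}.

(** Let x be the supremum of the t with [C p t]. The local condition at x bridges from a point just
    left of x to a point beyond it, unless q is reached; gluing then gives [C p q]. This form spares
    the construction of a fine tagged partition. *)
Lemma cousin (C : R -> R -> Prop) (p q : R) : p <= q ->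
  (forall s m t, s <= m -> m <= t -> C s m -> C m t -> C s t) ->
  (forall x, p <= x <= q -> exists2 r, 0 < r & forall s t,
     p <= s -> t <= q -> x - r < s -> s <= x -> x <= t -> t < x + r -> C s t) ->
  C p q.
Proof.
move=> pq trC locC.
pose S := [set t | p <= t <= q /\ C p t].
have Sp : S p.
  split; first by rewrite lexx.
  have [|r r0 rC] := locC p; first by rewrite lexx.
  by apply: rC => //; lra.
have ubS : ubound S q by move=> t [/andP[]].
have hS : has_sup S by split; [exists p|exists q].
have [px xq] : p <= sup S /\ sup S <= q.
  split; first exact: (ub_le_sup (ex_intro _ q ubS)).
  by apply: ge_sup => //; exists p.
have [|r r0 rC] := locC (sup S); first by rewrite px.
have [s [/andP[ps sq] Cs] xs] := sup_adherent r0 hS.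
have sx : s <= sup S by apply: (ub_le_sup (ex_intro _ q ubS)); split=> //; apply/andP.
pose t := Num.min (sup S + r / 2) q.
have tq : t <= q by rewrite ge_min lexx orbT.
have xt : sup S <= t by rewrite le_min xq andbT; lra.
have Ct : C p t.
  apply: (trC _ s) => //; first lra.
  by apply: rC => //; rewrite gt_min; apply/orP; left; lra.
have St : S t by split => //; rewrite tq andbT; lra.
have : t <= sup S by apply: (ub_le_sup (ex_intro _ q ubS)).
rewrite ge_min => /orP[|qx]; first lra.
have <- : t = q by apply/eqP; rewrite eq_le tq /=; lra.
by [].
Qed.

End Cousin.

Section AbsoluteContinuity.
Context {R : realType}.
Notation mu := (@lebesgue_measure R).

Lemma is_derive_eps (f : R -> R) (x k : R) : is_derive x 1 f k ->
  forall e, 0 < e -> exists2 r, 0 < r & forall y, `|y - x| < r ->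
    `|f y - f x - k * (y - x)| <= e * `|y - x|.
Proof.
move=> fk e e0.
have H : h^-1 * (f (h + x) - f x) @[h --> 0^'] --> k.
  have [/cvg_ex[l Hl] Dk] := fk.
  have -> : k = l by rewrite -Dk; apply/cvg_lim.
  apply: cvg_trans Hl; apply: near_eq_cvg; near=> h.
  by rewrite /= scaler1.
move/cvgrPdist_le : H => /(_ e e0); rewrite near_withinE => -[r /= r0 Hr].
exists r => // y yr; have [->|yx] := eqVneq y x.
  by rewrite !subrr mulr0 subrr normr0 mulr0.
have yx0 : y - x != 0 by rewrite subr_eq0.
have := Hr (y - x); rewrite /= sub0r normrN => /(_ yr yx0).
rewrite subrK => Hk.
have -> : f y - f x - k * (y - x) = - ((k - (y - x)^-1 * (f y - f x)) * (y - x)).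
  rewrite mulrBl -mulrA (mulrC (f y - f x)) mulrA mulVf// mul1r; ring.
by rewrite normrN normrM ler_wpM2r.
Unshelve. all: by end_near. Qed.

(* A left-to-right list of non-overlapping intervals (c, d) inside [s, t]. *)
Fixpoint chain (s : R) (l : seq (R * R)) (t : R) : bool :=
  if l is cd :: l' then [&& s <= cd.1, cd.1 <= cd.2 & chain cd.2 l' t]
  else s <= t.

Lemma chain_le s l t : chain s l t -> s <= t.
Proof.
elim: l s => [//|cd l IH] s /= /and3P[h1 h2 /IH]; lra.
Qed.

Lemma chain_cat s l1 m l2 t : chain s l1 m -> chain m l2 t -> chain s (l1 ++ l2) t.
Proof.
elim: l1 s => [|cd l IH] s /=.
  case: l2 => [|cd l] /=; first exact: le_trans.
  by move=> sm /and3P[h1 -> ->]; rewrite !andbT; lra.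
by move=> /and3P[-> -> /IH h] /h ->.
Qed.

Lemma chain_nth s l t : chain s l t -> forall i, (i < size l)%N ->
  [/\ s <= (nth (0, 0) l i).1, (nth (0, 0) l i).1 <= (nth (0, 0) l i).2 &
      (nth (0, 0) l i).2 <= t].
Proof.
elim: l s => [//|cd l IH] s /= /and3P[h1 h2 h3] [|i] /= il.
  by split=> //; exact: chain_le h3.
by have [] := IH _ h3 i il; split => //; lra.
Qed.

Lemma chain_lt s l t : chain s l t -> forall i j, (i < j)%N -> (j < size l)%N ->
  (nth (0, 0) l i).2 <= (nth (0, 0) l j).1.
Proof.
elim: l s => [//|cd l IH] s /= /and3P[h1 h2 h3] [|i] [|j] //= ij jl.
  by have [] := chain_nth h3 jl.
exact: (IH _ h3).
Qed.

(** Lists replace families indexed by ['I_n] because gluing two adjacent intervals in Cousin's lemma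
    concatenates their collections. *)
Lemma abs_continuous_chain (A : set R) (f : R -> R) : is_interval A ->
  abs_continuous_in A f -> forall e, 0 < e -> exists2 delta, 0 < delta &
  forall s t l, A s -> A t -> chain s l t -> \sum_(cd <- l) (cd.2 - cd.1) < delta ->
  \sum_(cd <- l) `|f cd.2 - f cd.1| < e.
Proof.
move=> iA acf e e0; have [delta d0 H] := acf e e0.
exists delta => // s t l As At cl.
rewrite !(big_nth (0, 0)) !big_mkord => Hl.
apply: (H _ (fun i : 'I_(size l) => (nth (0, 0) l i).1)
            (fun i : 'I_(size l) => (nth (0, 0) l i).2)) => // [i|].
  have [h1 h2 h3] := chain_nth cl (ltn_ord i).
  split => //; apply: (iA s t) => //; lra.
move=> i j _ _ [x /= []]; rewrite !in_itv /= => /andP[xi1 xi2] /andP[xj1 xj2].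
apply/val_inj/eqP; case: ltngtP => //.
  by move=> /(chain_lt cl)/(_ (ltn_ord j)); lra.
by move=> /(chain_lt cl)/(_ (ltn_ord i)); lra.
Qed.

End AbsoluteContinuity.

Section MonotoneAC.
Context {R : realType}.
Notation mu := (@lebesgue_measure R).

Lemma lebesgue_aeS (P Q : R -> Prop) : (forall x, P x -> Q x) ->
  {ae mu, forall x, P x} -> {ae mu, forall x, Q x}.
Proof. by move=> PQ; apply: (@filterS _ _ (ae_filter_ringOfSetsType mu)) => x; exact: PQ. Qed.

Lemma lebesgue_ae2 (P Q S : R -> Prop) : (forall x, P x -> Q x -> S x) ->
  {ae mu, forall x, P x} -> {ae mu, forall x, Q x} -> {ae mu, forall x, S x}.
Proof.
by move=> PQS; apply: filterS2 => //; exact: (ae_filter_ringOfSetsType mu).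
Qed.

Lemma lebesgue_measure_co (s t : R) : s <= t -> mu `[s, t[ = (t - s)%:E.
Proof.
move=> st; rewrite lebesgue_measure_itv /= lte_fin.
case: ltP => [//|ts]; have -> : t = s by lra.
by rewrite subrr.
Qed.

(* Cousin's lemma on a partition that is fine in two ways: an interval tagged by a
   point where h' <= 0 contributes at most e times its length, and the intervals
   tagged by exceptional points lie in an open set U of small measure, on which
   absolute continuity bounds the total variation. *)
Lemma ac_nonincreasing (p q : R) (h : R -> R) : p <= q ->
  abs_continuous_in `[p, q] h ->
  {ae mu, forall x, x \in `]p, q[ -> exists2 k, is_derive x 1 h k & k <= 0} ->
  h q <= h p.
Proof.
move=> pq ach [A [mA A0 subA]].
have ipq : is_interval `[p, q] by exact: interval_is_interval.
have Ap : [set` `[p, q]] p by rewrite /= in_itv /= lexx.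
have Aq : [set` `[p, q]] q by rewrite /= in_itv /= lexx andbT.
apply/ler_addgt0Pr => e0 e0_gt0.
pose e := e0 / (q - p + 1).
have D0 : 0 < q - p + 1 by lra.
have e_gt0 : 0 < e by rewrite divr_gt0.
have [delta d0 Hdelta] := abs_continuous_chain ipq ach e_gt0.
(* Both endpoints join the null set, since the derivative is controlled on the open interval
   only. *)
pose N := A `|` ([set p] `|` [set q]).
have mN : measurable N by apply: measurableU => //; apply: measurableU.
have N0 : mu N = 0%E.
  apply/(negligibleP _ mN); apply: negligibleU; first exact/negligibleP.
  by apply: negligibleU; apply/negligibleP => //; exact: lebesgue_measure_set1.
have [U [oU NU muU]] : exists U : set R, [/\ open U , N `<=` U & (mu (U `\` N) < delta%:E)%E].
  by apply: lebesgue_regularity_outer => //; rewrite /= ?N0 ?ltry.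
have mU : measurable U by exact: measurable_realfun.open_measurable.
have muU' : (mu U < delta%:E)%E.
  apply: le_lt_trans muU; rewrite -[X in (mu X <= _)%E](setDUK NU).
  apply: (le_trans (measureU2 _ _ _)) => //; first exact: measurableD.
  by rewrite [X in (X + _)%E]N0 add0e.
(* The total length of the list is compared with the measure of [U] over [s, t[, not with [delta]:
   that measure is additive over adjacent half-open intervals, so [C] survives gluing. *)
pose C s t := s <= t /\ exists l, [/\ chain s l t,
   ((\sum_(cd <- l) (cd.2 - cd.1))%:E <= mu (U `&` `[s, t[%classic))%E &
   h t - h s <= e * (t - s) + \sum_(cd <- l) `|h cd.2 - h cd.1|].
suff [_ [l [cl l1 l2]]] : C p q.
  have l3 : \sum_(cd <- l) (cd.2 - cd.1) < delta.
    rewrite -lte_fin; apply: (le_lt_trans l1); apply: le_lt_trans muU'.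
    by apply: le_measure; rewrite ?inE//; exact: measurableI.
  have := Hdelta _ _ _ Ap Aq cl l3.
  have : e * (q - p + 1) = e0 by rewrite /e divfK// gt_eqF.
  lra.
apply: cousin => //.
  move=> s m t sm mt [_ [l1 [c1 a1 b1]]] [_ [l2 [c2 a2 b2]]].
  split; first lra.
  exists (l1 ++ l2); split; first exact: chain_cat c1 c2.
    rewrite big_cat /= EFinD; apply: (le_trans (leeD a1 a2)).
    rewrite -measureU; [|exact: measurableI|exact: measurableI|].
      apply: le_measure; rewrite ?inE; [|exact: measurableI|].
        by apply: measurableU; exact: measurableI.
      by move=> x [] [Ux xst]; split => //; move: xst;
        rewrite /= !in_itv /= => /andP[x1 x2]; rewrite ?x1 ?x2 ?(le_trans sm)//;
        rewrite (lt_le_trans x2).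
    rewrite -subset0 => x [[Ux xs] [_ xt]]; move: xs xt.
    by rewrite /= !in_itv /= => /andP[_ x2] /andP[/(lt_le_trans x2)]; rewrite ltxx.
  by rewrite big_cat /=; nra.
move=> x /andP[px xq].
have [Ux|nUx] := pselect (U x).
  have [r r0 rU] : exists2 r, 0 < r & ball x r `<=` U.
    by have /nbhs_ballP[r r0 rU] := open_nbhs_nbhs (conj oU Ux); exists r.
  exists r => // s t ps tq xs sx xt tx; split; first lra.
  have st : s <= t by lra.
  exists [:: (s, t)]; split => /=; first by rewrite !lexx st.
    rewrite big_seq1 /= (_ : U `&` _ = `[s, t[%classic) ?lebesgue_measure_co//.
    apply/seteqP; split => [y []//|y /= yst]; split => //; apply: rU.
    by move: yst; rewrite /ball /= in_itv /= => /andP[y1 y2]; rewrite ltr_norml; lra.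
  rewrite big_seq1 /=; have := ler_norm (h t - h s); nra.
have xpq : x \in `]p, q[.
  rewrite in_itv /=; apply/andP; split.
    rewrite lt_neqAle px andbT; apply/eqP => pxE; apply: nUx; apply: NU.
    by right; left.
  rewrite lt_neqAle xq andbT; apply/eqP => pxE; apply: nUx; apply: NU.
  by right; right.
have [k hk k0] : exists2 k, is_derive x 1 h k & k <= 0.
  apply: contrapT => nk; apply: nUx; apply: NU; left; apply: subA => /= H.
  exact/nk/H.
have [r r0 Hr] := is_derive_eps hk e_gt0.
exists r => // s t ps tq xs sx xt tx; split; first lra.
exists [::]; split => /=; first lra.
  by rewrite big_nil measure_ge0.
rewrite big_nil addr0.
have := Hr t; have := Hr s.
rewrite !ler_norml (ger0_norm (_ : 0 <= t - x)); last lra.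
rewrite (ler0_norm (_ : s - x <= 0)); last lra.
move=> /(_ ltac:(lra))/andP[H1 H2] /(_ ltac:(lra))/andP[H3 H4].
nra.
Qed.

End MonotoneAC.

(** * Derivatives relative to an interval *)

Section C1Interval.
Context {R : realType}.
Implicit Types (A : set R) (f u v : R -> R).

Lemma within_continuousE A f : {within A, continuous f} <->
  forall x, A x -> forall e, 0 < e -> exists2 r, 0 < r &
    forall y, A y -> `|y - x| < r -> `|f y - f x| < e.
Proof.
split => [/subspace_continuousP cf x Ax e e0|H].
  have /cvgrPdist_lt/(_ e e0) := cf x Ax.
  rewrite near_withinE => /nbhs_ballP[r /= r0 Hr]; exists r => // y Ay yx.
  by rewrite distrC; apply: Hr => //; rewrite /ball /= distrC.
apply/subspace_continuousP => x Ax; apply/cvgrPdist_lt => e e0.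
rewrite near_withinE; have [r r0 Hr] := H x Ax e e0.
apply/nbhs_ballP; exists r => //= y yx Ay; rewrite distrC; apply: Hr => //.
by rewrite distrC.
Qed.

(** Multiplying out the quotient admits y = x, so later estimates avoid punctured neighbourhoods and
    division. *)
Lemma has_deriv_inE A f (x l : R) : has_deriv_in A f x l <->
  forall e, 0 < e -> exists2 r, 0 < r & forall y, A y -> `|y - x| < r ->
    `|f y - f x - l * (y - x)| <= e * `|y - x|.
Proof.
have E y : y != x -> f y - f x - l * (y - x) = - ((l - (f y - f x) / (y - x)) * (y - x)).
  by move=> yx; rewrite mulrBl divfK ?subr_eq0// opprB.
split => [H e e0|H].
  move/cvgrPdist_le : H => /(_ e e0); rewrite near_withinE => /nbhs_ballP[r /= r0 Hr].
  exists r => // y Ay yr; have [->|yx] := eqVneq y x.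
    by rewrite !subrr mulr0 subrr normr0 mulr0.
  rewrite E// normrN normrM ler_wpM2r//; apply: Hr => //.
  by rewrite /ball /= distrC.
apply/cvgrPdist_le => e e0; rewrite near_withinE.
have [r r0 Hr] := H e e0.
apply/nbhs_ballP; exists r => //= y yx yNx Ay.
have := Hr y Ay; rewrite distrC => /(_ yx).
by rewrite E// normrN normrM distrC ler_pM2r// normr_gt0 subr_eq0.
Qed.

Lemma has_deriv_inS A B f x l : B `<=` A -> has_deriv_in A f x l ->
  has_deriv_in B f x l.
Proof.
move=> BA /has_deriv_inE H; apply/has_deriv_inE => e /H[r r0 Hr].
by exists r => // y /BA; exact: Hr.
Qed.

Lemma C1_inS A B u v : B `<=` A -> C1_in A u v -> C1_in B u v.
Proof.
move=> BA [du cv]; split => [x /BA /du|]; first exact: has_deriv_inS.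
exact: continuous_subspaceW cv.
Qed.

Lemma is_derive_has_deriv_in A f (x l : R) : is_derive x 1 f l -> has_deriv_in A f x l.
Proof.
move=> dl; apply/has_deriv_inE => e e0.
by have [r r0 Hr] := is_derive_eps dl e0; exists r => // y _; exact: Hr.
Qed.

Lemma is_derive_epsP f (x k : R) : (forall e, 0 < e -> exists2 r, 0 < r &
  forall y, `|y - x| < r -> `|f y - f x - k * (y - x)| <= e * `|y - x|) ->
  is_derive x 1 f k.
Proof.
move=> H.
have : h^-1 *: ((f \o shift x) (h *: (1 : R)) - f x) @[h --> 0^'] --> k.
  apply/cvgrPdist_le => e e0; rewrite near_withinE.
  have [r r0 Hr] := H e e0.
  apply/nbhs_ballP; exists r => //= h; rewrite /ball /= sub0r normrN => hr h0.
  have := Hr (h + x); rewrite addrK => /(_ hr).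
  have -> : f (h + x) - f x - k * h = - ((k - h^-1 * (f (h + x) - f x)) * h).
    by rewrite mulrBl (mulrC _^-1) divfK// opprB.
  by rewrite normrN normrM ler_pM2r ?normr_gt0// [h%:A]mulr1.
move=> cvk; apply: DeriveDef; last exact: cvg_lim cvk.
by apply/cvg_ex; exists k.
Qed.

Lemma C1_in_continuous A u v : C1_in A u v -> {within A, continuous u}.
Proof.
move=> [du _]; apply/within_continuousE => x Ax e e0.
have /has_deriv_inE /(_ 1 ltr01) [r r0 Hr] := du x Ax.
have D : 0 < 1 + `|v x| by have := normr_ge0 (v x); lra.
exists (Num.min r (e / (1 + `|v x|))); first by rewrite lt_min r0 divr_gt0.
move=> y Ay; rewrite lt_min => /andP[yr ye].
have := Hr y Ay yr; rewrite mul1r => H.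
apply: (@le_lt_trans _ _ ((1 + `|v x|) * `|y - x|)).
  rewrite mulrDl mul1r -normrM.
  by have := ler_normD (u y - u x - v x * (y - x)) (v x * (y - x)); rewrite subrK; lra.
by rewrite mulrC -ltr_pdivlMr.
Qed.

Lemma C1_in_is_derive (p q : R) u v x : C1_in `[p, q] u v -> x \in `]p, q[ ->
  is_derive x 1 u (v x).
Proof.
move=> [du _]; rewrite in_itv /= => /andP[px xq].
apply: is_derive_epsP => e e0.
have : `[p, q]%classic x by rewrite /= in_itv /= !ltW.
move=> /du/has_deriv_inE/(_ e e0)[r r0 Hr].
exists (Num.min r (Num.min (x - p) (q - x))); first by rewrite !lt_min; apply/and3P; split; lra.
move=> y; rewrite !lt_min => /and3P[yr].
rewrite !ltr_norml => /andP[y1 y2] /andP[y3 y4]; apply: Hr => //=.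
by rewrite in_itv /=; apply/andP; split; lra.
Qed.

Lemma C1_in_mvt (p q : R) u v x y : C1_in `[p, q] u v -> p <= x -> x < y -> y <= q ->
  exists z, [/\ x < z, z < y & u y - u x = v z * (y - x)].
Proof.
move=> C1 px xy yq.
have C1' : C1_in `[x, y] u v.
  by apply: C1_inS C1 => z /=; rewrite !in_itv /= => /andP[]; lra.
have [|z] := @MVT _ u v x y xy _ (C1_in_continuous C1').
  by move=> z zxy; exact: C1_in_is_derive C1' zxy.
by rewrite in_itv /= => /andP[]; exists z.
Qed.

Lemma C1_in_reflect (p q : R) u v : C1_in `[p, q] u v ->
  C1_in `[- q, - p] (fun x => u (- x)) (fun x => - v (- x)).
Proof.
move=> C1; have I x : `[- q, - p]%classic x -> `[p, q]%classic (- x).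
  by rewrite /= !in_itv /= => /andP[]; lra.
split.
  move=> x xI; apply/has_deriv_inE => e /(proj1 (has_deriv_inE _ _ _ _) (C1.1 _ (I x xI))).
  move=> [r r0 Hr]; exists r => // y yI yx.
  have -> : - v (- x) * (y - x) = v (- x) * (- y - - x) by ring.
  have -> : `|y - x| = `|- y - - x| by rewrite -opprD normrN.
  by apply: Hr; [exact: I|rewrite -opprD normrN].
apply/within_continuousE => x xI e e0.
have [r r0 Hr] := proj1 (within_continuousE _ _) C1.2 _ (I x xI) e e0.
exists r => // y yI yx; rewrite -opprD normrN; apply: Hr; first exact: I.
by rewrite -opprD normrN.
Qed.

Lemma C1_in_opp (A : set R) u v : C1_in A u v -> C1_in A (fun x => - u x) (fun x => - v x).
Proof.
move=> C1; split.
  move=> x xI; apply/has_deriv_inE => e /(proj1 (has_deriv_inE _ _ _ _) (C1.1 _ xI)).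
  move=> [r r0 Hr]; exists r => // y yI yx.
  have -> : - u y - - u x - - v x * (y - x) = - (u y - u x - v x * (y - x)) by ring.
  by rewrite normrN; exact: Hr.
apply/within_continuousE => x xI e e0.
have [r r0 Hr] := proj1 (within_continuousE _ _) C1.2 _ xI e e0.
by exists r => // y yI yx; rewrite -opprD normrN; exact: Hr.
Qed.

Lemma C1_in_subcst (A : set R) u v (M : R) : C1_in A u v -> C1_in A (fun x => u x - M) v.
Proof.
move=> [du cv]; split => // x /du /has_deriv_inE H; apply/has_deriv_inE => e /H[r r0 Hr].
by exists r => // y; rewrite opprB addrA subrK; exact: Hr.
Qed.

Lemma C1_in_lip (p q V : R) u v : C1_in `[p, q] u v ->
  (forall x, p <= x <= q -> `|v x| <= V) ->
  forall x y, p <= x <= q -> p <= y <= q -> `|u x - u y| <= V * `|x - y|.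
Proof.
move=> C1 HV x y.
wlog xy : x y / x < y => [H|].
  have [xy|xy|->] := ltgtP x y; first exact: H.
    by move=> hx hy; rewrite distrC (distrC x); exact: H.
  by rewrite !subrr normr0 mulr0.
move=> /andP[px _] /andP[_ yq].
have [z [xz zy E]] := C1_in_mvt C1 px xy yq.
by rewrite distrC E normrM (distrC x) ler_wpM2r// HV//; lra.
Qed.

(** A positive slope at q would push u below [u q] just to the left of q. The test point is taken
    close to q, yet inside the interval. *)
Lemma C1_in_right_end (p q : R) u v : p < q -> C1_in `[p, q] u v ->
  (forall x, p < x < q -> u q <= u x) -> v q <= 0.
Proof.
move=> pq C1 H; rewrite leNgt; apply/negP => v0.
have qI : `[p, q]%classic q by rewrite /= in_itv /= lexx ltW.
have v2 : 0 < v q / 2 by rewrite divr_gt0.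
have [r r0 Hr] := proj1 (has_deriv_inE _ _ _ _) (C1.1 _ qI) _ v2.
pose x := Num.max ((p + q) / 2) (q - r / 2).
have x1 : (p + q) / 2 <= x by rewrite le_max lexx.
have x2 : q - r / 2 <= x by rewrite le_max lexx orbT.
have x3 : x < q by rewrite gt_max; apply/andP; split; lra.
have := Hr x; rewrite ltr0_norm ?subr_lt0// => {}Hr.
have : `|u x - u q - v q * (x - q)| <= v q / 2 * - (x - q).
  by apply: Hr; [rewrite /= in_itv /=; lra|lra].
rewrite ler_norml => /andP[_ h].
have := H x ltac:(lra); have : 0 < v q * (q - x) by rewrite mulr_gt0//; lra.
lra.
Qed.

Lemma C1_in_left_end (p q : R) u v : p < q -> C1_in `[p, q] u v ->
  (forall x, p < x < q -> u p <= u x) -> 0 <= v p.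
Proof.
move=> pq C1 H; have qp : - q < - p by rewrite ltrN2.
have := C1_in_right_end qp (C1_in_reflect C1); rewrite opprK oppr_le0; apply.
by move=> x hx; apply: H; lra.
Qed.

Lemma within_continuous_bounded (p q : R) f : p <= q -> {within `[p, q], continuous f} ->
  exists2 M, 0 < M & forall x, p <= x <= q -> `|f x| <= M.
Proof.
move=> pq cf.
have [c cpq Hc] := EVT_max pq cf; have [d dpq Hd] := EVT_min pq cf.
exists (`|f c| + `|f d| + 1); first by rewrite ltr_wpDl// addr_ge0.
move=> x xpq; have xi : x \in `[p, q] by rewrite in_itv.
have := Hc _ xi; have := Hd _ xi; rewrite ler_norml.
have := ler_norm (f c); have := ler_norm (- f d); rewrite normrN.
have := normr_ge0 (f c); have := normr_ge0 (f d); lra.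
Qed.

End C1Interval.

(** * Calculus of absolutely continuous functions *)

Section ACPrimitive.
Context {R : realType}.
Notation mu := (@lebesgue_measure R).
Implicit Types (p q : R) (f g h k : R -> R).

(** Stands for f = f(p) + \int k without mentioning an integral: end values are compared through the
    sign of k, by [ac_primitive_le]. *)
Definition ac_primitive p q f k :=
  abs_continuous_in `[p, q] f /\
  {ae mu, forall x, x \in `]p, q[ -> is_derive x 1 f (k x)}.

Lemma abs_continuous_inS (A B : set R) f : B `<=` A ->
  abs_continuous_in A f -> abs_continuous_in B f.
Proof.
move=> BA acf e /acf[d d0 H]; exists d => // n c c' Bc; apply: H => i.
by have [/BA ? /BA ? ?] := Bc i.
Qed.

Lemma ac_primitiveS p q p' q' f k : p <= p' -> q' <= q ->
  ac_primitive p q f k -> ac_primitive p' q' f k.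
Proof.
move=> pp qq [acf df]; split.
  by apply: abs_continuous_inS acf => x /=; rewrite !in_itv /= => /andP[]; lra.
apply: lebesgue_aeS df => x H; rewrite in_itv /= => /andP[x1 x2]; apply: H.
by rewrite in_itv /=; lra.
Qed.

Lemma ac_primitive_le p q f k : p <= q -> ac_primitive p q f k ->
  {ae mu, forall x, x \in `]p, q[ -> k x <= 0} -> f q <= f p.
Proof.
move=> pq [acf df] k0; apply: ac_nonincreasing => //.
apply: lebesgue_ae2 df k0 => x H1 H2 xpq; exists (k x); [exact: H1|exact: H2].
Qed.

Lemma eq_ac_primitive p q f k k' :
  {ae mu, forall x, x \in `]p, q[ -> k x = k' x} ->
  ac_primitive p q f k -> ac_primitive p q f k'.
Proof.
move=> kk [acf df]; split => //.
by apply: lebesgue_ae2 kk df => x H1 H2 xpq; rewrite -H1//; exact: H2.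
Qed.

Lemma abs_continuous_continuous (A : set R) f : is_interval A ->
  abs_continuous_in A f -> {within A, continuous f}.
Proof.
move=> iA acf; apply/within_continuousE => x Ax e e0.
have [d d0 H] := acf e e0; exists d => // y Ay yx.
have K s t : A s -> A t -> s <= t -> t - s < d -> `|f t - f s| < e.
  move=> As At st ts.
  have := H 1%N (fun=> s) (fun=> t); rewrite !big_ord1; apply => //.
  by move=> i j _ _ _; rewrite !ord1.
have [xy|yx'] := leP x y.
  by apply: K => //; move: yx; rewrite ger0_norm ?subr_ge0.
rewrite distrC; apply: K => //; first exact: ltW.
by move: yx; rewrite distrC gtr0_norm ?subr_gt0.
Qed.

Lemma ac_primitive_continuous p q f k : ac_primitive p q f k ->
  {within `[p, q], continuous f}.
Proof.
by move=> [acf _]; apply: abs_continuous_continuous => //; exact: interval_is_interval.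
Qed.

(** Increments dominated by those of two absolutely continuous functions: this one estimate covers
    sums, products, exponentials and C1 functions. *)
Lemma abs_continuous_lip (A : set R) f g h M : 0 < M ->
  (forall x y, A x -> A y -> `|h x - h y| <= M * (`|f x - f y| + `|g x - g y|)) ->
  abs_continuous_in A f -> abs_continuous_in A g -> abs_continuous_in A h.
Proof.
move=> M0 hM acf acg e e0.
have e1 : 0 < e / (2 * M) by rewrite divr_gt0// mulr_gt0.
have [d1 d10 H1] := acf _ e1; have [d2 d20 H2] := acg _ e1.
exists (Num.min d1 d2); first by rewrite lt_min d10.
move=> n c d Acd tr; rewrite lt_min => /andP[l1 l2].
apply: (@le_lt_trans _ _ (\sum_(i < n) M * (`|f (d i) - f (c i)| + `|g (d i) - g (c i)|))).
  by apply: ler_sum => i _; apply: hM; have [] := Acd i.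
rewrite -mulr_sumr big_split /=.
have E : e = M * (e / (2 * M) + e / (2 * M)) by field; rewrite gt_eqF.
by rewrite [X in _ < X]E ltr_pM2l// ltrD// ?H1 ?H2.
Qed.

Lemma ac_primitiveD p q f g k l : ac_primitive p q f k -> ac_primitive p q g l ->
  ac_primitive p q (fun x => f x + g x) (fun x => k x + l x).
Proof.
move=> [acf df] [acg dg]; split.
  apply: (@abs_continuous_lip _ f g _ 1) => // x y _ _.
  by rewrite mul1r opprD addrACA ler_normD.
by apply: lebesgue_ae2 df dg => x H1 H2 xpq; apply: is_deriveD; [exact: H1|exact: H2].
Qed.

Lemma ac_primitive_cst p q (c : R) : ac_primitive p q (fun=> c) (fun=> 0).
Proof.
split; last by apply: aeW => x _; exact: is_derive_cst.
move=> e e0; exists 1 => // n a b _ _ _.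
by rewrite big1// => i _; rewrite subrr normr0.
Qed.

Lemma ac_primitive_id p q : ac_primitive p q idfun (fun=> 1).
Proof.
split; last by apply: aeW => x _; exact: is_derive_id.
move=> e e0; exists e => // n a b ab _.
apply: le_lt_trans; apply: ler_sum => i _.
by have [_ _ ?] := ab i; rewrite ger0_norm ?subr_ge0.
Qed.

Lemma ac_primitiveM p q f g k l : p <= q -> ac_primitive p q f k -> ac_primitive p q g l ->
  ac_primitive p q (fun x => f x * g x) (fun x => f x * l x + g x * k x).
Proof.
move=> pq hf hg.
have [M M0 HM] := within_continuous_bounded pq (ac_primitive_continuous hf).
have [N N0 HN] := within_continuous_bounded pq (ac_primitive_continuous hg).
have [[acf df] [acg dg]] := (hf, hg); split.
  apply: (@abs_continuous_lip _ f g _ (M + N)) => //; first exact: addr_gt0.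
  move=> x y /=; rewrite !in_itv /= => xpq ypq.
  have -> : f x * g x - f y * g y = (f x - f y) * g x + f y * (g x - g y) by ring.
  rewrite (le_trans (ler_normD _ _))// !normrM.
  have := HM y ypq; have := HN x xpq.
  have := normr_ge0 (f x - f y); have := normr_ge0 (g x - g y); nra.
apply: lebesgue_ae2 df dg => x H1 H2 xpq.
by have := is_deriveM (H1 xpq) (H2 xpq).
Qed.

Lemma ac_primitiveZ p q (c : R) f k : p <= q -> ac_primitive p q f k ->
  ac_primitive p q (fun x => c * f x) (fun x => c * k x).
Proof.
move=> pq hf; have := ac_primitiveM pq (ac_primitive_cst p q c) hf.
by apply: eq_ac_primitive; apply: aeW => x _; rewrite mulr0 addr0.
Qed.

Lemma ac_primitive_expR p q f k : p <= q -> ac_primitive p q f k ->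
  ac_primitive p q (fun x => expR (f x)) (fun x => expR (f x) * k x).
Proof.
move=> pq hf.
have [M M0 HM] := within_continuous_bounded pq (ac_primitive_continuous hf).
have [acf df] := hf; split.
  apply: (@abs_continuous_lip _ f f _ (expR M)) => //; first exact: expR_gt0.
  (* From 1 + (t - s) <= exp (t - s): exp s - exp t <= exp s * (s - t), and exp s <= exp M on the
     range of f. *)
  have K s t : s <= M -> expR s - expR t <= expR M * `|s - t|.
    move=> sM; have := expR_ge1Dx (t - s).
    rewrite expRD expRN => H.
    have e1 := expR_gt0 s.
    have {}H : expR s * (1 + (t - s)) <= expR t.
      by rewrite mulrC -ler_pdivlMr.
    have : expR s <= expR M by rewrite ler_expR.
    have := ler_norm (s - t); have := normr_ge0 (s - t).
    nra.
  move=> x y /=; rewrite !in_itv /= => /HM xpq /HM ypq.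
  have kx : f x <= M by apply: le_trans xpq; exact: ler_norm.
  have ky : f y <= M by apply: le_trans ypq; exact: ler_norm.
  have := K _ (f y) kx; have := K _ (f x) ky; rewrite (distrC (f y)).
  have e1 := expR_gt0 M; have := normr_ge0 (f x - f y).
  by rewrite ler_norml; nra.
apply: lebesgue_aeS df => x H xpq.
have := @is_derive1_comp _ expR f x _ _ (is_derive_expR (f x)) (H xpq).
by rewrite mulrC.
Qed.

Lemma C1_in_ac p q u v : p <= q -> C1_in `[p, q] u v -> ac_primitive p q u v.
Proof.
move=> pq C1; split; last by apply: aeW => x xpq; exact: C1_in_is_derive C1 xpq.
have [M M0 HM] := within_continuous_bounded pq C1.2.
have [aci _] := ac_primitive_id p q.
apply: (abs_continuous_lip M0 _ aci aci) => x y /=.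
wlog xy : x y / x <= y => [H xpq ypq|].
  have [xy|/ltW yx] := leP x y; first exact: H.
  by rewrite distrC !(distrC x); apply: H.
rewrite !in_itv /= => /andP[px _] /andP[_ yq].
move: xy; rewrite le_eqVlt => /predU1P[->|xy]; first by rewrite !subrr normr0 addr0 mulr0.
have [z [xz zy E]] := C1_in_mvt C1 px xy yq.
rewrite distrC E normrM (distrC x).
have := HM z; have := normr_ge0 (y - x); have -> : p <= z <= q by lra.
by move=> h1 /(_ isT); nra.
Qed.

End ACPrimitive.

(** * Primitives of Lebesgue integrable functions *)

Section Primitive.
Context {R : realType}.
Notation mu := (@lebesgue_measure R).
Implicit Types (f g h k : R -> R).

Definition primitive h (x : R) : R := \int[mu]_(t in `]-oo, x]) h t.

Definition lebesgue_integrable h := mu.-integrable [set: R] (EFin \o h).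

Lemma lebesgue_integrableS h (A : set R) : measurable A -> lebesgue_integrable h ->
  mu.-integrable A (EFin \o h).
Proof. by move=> mA; apply: integrableS. Qed.

Lemma lebesgue_integrable_normr h : lebesgue_integrable h -> lebesgue_integrable (fun x => `|h x|).
Proof. by move=> /integrable_abse. Qed.

Lemma primitiveE h (x y : R) : lebesgue_integrable h -> x <= y ->
  primitive h y - primitive h x = \int[mu]_(t in `]x, y]) h t.
Proof.
move=> ih xy; rewrite /primitive Rintegral_itvB ?bnd_simp//.
exact: lebesgue_integrableS.
Qed.

Lemma primitive_le h (x y : R) : lebesgue_integrable h -> (forall t, 0 <= h t) -> x <= y ->
  primitive h x <= primitive h y.
Proof.
move=> ih h0 xy; rewrite -subr_ge0 primitiveE//.
by apply: Rintegral_ge0.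
Qed.

(** The sum of increments is at most the integral of |h| over the union of the disjoint intervals,
    which is small when the measure of that union is small. *)
Lemma abs_continuous_primitive (A : set R) h : lebesgue_integrable h -> abs_continuous_in A (primitive h).
Proof.
move=> ih e e0.
have [delta [d0 H]] := integral_normr_continuous ih e0.
exists delta => // n c d cd tr sd.
pose F (i : 'I_n) := `]c i, d i[%classic.
pose U := \big[setU/set0]_(i < n) F i.
have mF i : measurable (F i) by exact: measurable_itv.
have mU : measurable U by exact: bigsetU_measurable.
have muU : (mu U < delta%:E)%E.
  rewrite measure_bigsetU_ord//=.
  rewrite (eq_bigr (fun i => (d i - c i)%:E)) ?sumEFin ?lte_fin// => i _.
  have [_ _ cdi] := cd i.
  rewrite /F lebesgue_measure_itv /= lte_fin; case: ltP => // dc.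
  by have -> : c i = d i; [apply/eqP; rewrite eq_le cdi dc|rewrite subrr].
apply: le_lt_trans (H _ mU muU).
have -> : \int[mu]_(x in U) `|h x| = \sum_(i < n) \int[mu]_(x in F i) `|h x|.
  rewrite /Rintegral integral_bigsetU_EFin//=.
  - rewrite sum_fine// => i _; apply: integrable_fin_num; first exact: mF.
    by apply: (@lebesgue_integrableS (fun x => `|h x|)); [exact: mF|exact: lebesgue_integrable_normr].
  - exact: index_enum_uniq.
  - by apply: sub_trivIset tr.
  - apply: (measurable_int mu).
    by apply: (@lebesgue_integrableS (fun x => `|h x|)); [exact: mU|exact: lebesgue_integrable_normr].
apply: ler_sum => i _; have [_ _ cdi] := cd i.
rewrite primitiveE// /F -Rintegral_itv_bndo_bndc; last exact: lebesgue_integrableS.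
by apply: le_normr_Rintegral => //; exact: lebesgue_integrableS.
Qed.

Lemma primitive_ac p q h : lebesgue_integrable h -> ac_primitive p q (primitive h) h.
Proof.
move=> ih; split; first exact: abs_continuous_primitive.
have loc : locally_integrable setT h.
  by apply: open_integrable_locally => //; exact: openT.
have := @FTC1Ny R h (fun y => lebesgue_integrableS (measurable_itv _) ih) loc.
apply: lebesgue_aeS => x [dF <-] _; rewrite derive1E; exact: DeriveDef.
Qed.

Lemma primitive_continuous h : lebesgue_integrable h -> continuous (primitive h).
Proof.
move=> ih; have iT : is_interval [set: R] by [].
have := abs_continuous_continuous iT (@abs_continuous_primitive setT _ ih).
by move=> /(proj2 (continuous_subspace_setT _)).
Qed.

End Primitive.

(** * The initial value problem *)

Section InitialValueProblem.
Context {R : realType}.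
Notation mu := (@lebesgue_measure R).
Implicit Types (p q : R) (a f u v : R -> R).

Lemma ac_primitiveN p q f k : p <= q -> ac_primitive p q f k ->
  ac_primitive p q (fun x => - f x) (fun x => - k x).
Proof.
move=> pq /(ac_primitiveZ (-1) pq); congr (ac_primitive _ _ _ _);
by apply/funext => x; rewrite mulN1r.
Qed.

Lemma ac_primitiveB p q f g k l : p <= q ->
  ac_primitive p q f k -> ac_primitive p q g l ->
  ac_primitive p q (fun x => f x - g x) (fun x => k x - l x).
Proof. by move=> pq hf /(ac_primitiveN pq); exact: ac_primitiveD. Qed.

Lemma ac_primitive_ge p q f k : p <= q -> ac_primitive p q f k ->
  {ae mu, forall x, x \in `]p, q[ -> 0 <= k x} -> f p <= f q.
Proof.
move=> pq /(ac_primitiveN pq) hf k0; rewrite -lerN2.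
apply: (ac_primitive_le pq hf).
by apply: lebesgue_aeS k0 => x H /H; rewrite oppr_le0.
Qed.

(** The two bounds come from the integrating factors exp (-B) and exp B. The second one runs
    backwards: it later allows initial data to be estimated from an interior point. *)
Lemma gronwall_ac p q (E E' B b : R -> R) : p <= q ->
  ac_primitive p q E E' -> ac_primitive p q B b ->
  {ae mu, forall x, x \in `]p, q[ -> `|E' x| <= b x * E x} ->
  E q <= expR (B q - B p) * E p /\ E p <= expR (B q - B p) * E q.
Proof.
move=> pq hE hB Eb; split.
  have h := ac_primitiveM pq hE (ac_primitive_expR pq (ac_primitiveN pq hB)).
  have := ac_primitive_le pq h; rewrite !expRN => H.
  rewrite expRD expRN -mulrA mulrC -ler_pdivrMr ?expR_gt0// [leRHS]mulrC; apply: H.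
  apply: lebesgue_aeS Eb => x H /H; rewrite ler_norml => /andP[h1 h2].
  have := expR_gt0 (- B x); nra.
have h := ac_primitiveM pq hE (ac_primitive_expR pq hB).
have := ac_primitive_ge pq h => H.
rewrite expRD expRN mulrAC -ler_pdivrMr ?invr_gt0 ?expR_gt0// invrK [leRHS]mulrC; apply: H.
apply: lebesgue_aeS Eb => x H /H; rewrite ler_norml => /andP[h1 h2].
have := expR_gt0 (B x); nra.
Qed.

(** Working version of [solves], for [lebesgue_measure] and with the equation on the open interval;
    [ivp_solves] converts back. *)
Definition ivp_sol a f p q u v :=
  C1_in `[p, q] u v /\ ac_primitive p q v (fun x => - (a x * f (u x))).

Lemma ivp_solS a f p q p' q' u v : p <= p' -> q' <= q ->
  ivp_sol a f p q u v -> ivp_sol a f p' q' u v.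
Proof.
move=> pp qq [C1 acv]; split; last exact: ac_primitiveS acv.
by apply: C1_inS C1 => x /=; rewrite !in_itv /= => /andP[]; lra.
Qed.

Definition lipschitzian f (L : R) := forall s t, `|f s - f t| <= L * `|s - t|.

Definition dist2 (u1 v1 u2 v2 : R -> R) (x : R) : R :=
  (u1 x - u2 x) ^+ 2 + (v1 x - v2 x) ^+ 2.

(* |E'| <= (1 + L |a|) E for E = dist2, hence E exp(-B) decreases and E exp(B)
   increases, with B' = 1 + L |a|. *)
Lemma ivp_gronwall a f L p q u1 v1 u2 v2 : lebesgue_integrable a -> 0 <= L -> lipschitzian f L ->
  p <= q -> ivp_sol a f p q u1 v1 -> ivp_sol a f p q u2 v2 ->
  let K := expR (q - p + L * (primitive (fun t => `|a t|) q - primitive (fun t => `|a t|) p)) in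
  forall s t, p <= s <= q -> p <= t <= q ->
  dist2 u1 v1 u2 v2 t <= K * dist2 u1 v1 u2 v2 s.
Proof.
move=> ia L0 lf pq s1 s2 K.
have iB : lebesgue_integrable (fun t => `|a t|) by exact: lebesgue_integrable_normr.
pose B x := x + L * primitive (fun t => `|a t|) x.
have E0 x : 0 <= dist2 u1 v1 u2 v2 x by rewrite addr_ge0// sqr_ge0.
have key s t : p <= s -> s <= t -> t <= q ->
    dist2 u1 v1 u2 v2 t <= expR (B t - B s) * dist2 u1 v1 u2 v2 s /\
    dist2 u1 v1 u2 v2 s <= expR (B t - B s) * dist2 u1 v1 u2 v2 t.
  move=> ps st tq.
  have [c1 d1] := ivp_solS ps tq s1; have [c2 d2] := ivp_solS ps tq s2.
  have du := ac_primitiveB st (C1_in_ac st c1) (C1_in_ac st c2).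
  have dv := ac_primitiveB st d1 d2.
  have dE := ac_primitiveD (ac_primitiveM st du du) (ac_primitiveM st dv dv).
  have dB := ac_primitiveD (ac_primitive_id s t) (ac_primitiveZ L st (primitive_ac s t iB)).
  apply: (gronwall_ac st (E := dist2 u1 v1 u2 v2) _ dB).
    by move: dE; congr (ac_primitive _ _ _ _).
  apply: aeW => x _ /=; rewrite /dist2.
  set U := u1 x - u2 x; set V := v1 x - v2 x.
  have lU : `|f (u1 x) - f (u2 x)| <= L * `|U| by exact: lf.
  have -> : - (a x * f (u1 x)) - - (a x * f (u2 x)) = - (a x * (f (u1 x) - f (u2 x))) by ring.
  set D := f (u1 x) - f (u2 x) in lU *.
  have -> : U * V + U * V + (V * - (a x * D) + V * - (a x * D)) =
    2 * U * V - 2 * (V * a x * D) by ring.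
  rewrite (le_trans (ler_normB _ _))// !normrM !normr_nat.
  rewrite -(real_normK (num_real U)) -(real_normK (num_real V)).
  have h1 := normr_ge0 U; have h2 := normr_ge0 V; have h3 := normr_ge0 (a x).
  have h4 : `|V| * `|a x| * `|D| <= `|V| * `|a x| * (L * `|U|).
    by rewrite ler_wpM2l// mulr_ge0.
  have h5 : 2 * (`|U| * `|V|) <= `|U| ^+ 2 + `|V| ^+ 2.
    by have := sqr_ge0 (`|U| - `|V|); nra.
  have h6 : 0 <= L * `|a x| by rewrite mulr_ge0.
  have h7 := ler_wpM2l h6 h5.
  lra.
have mB x y : x <= y -> B x <= B y.
  by move=> xy; rewrite lerD// ler_wpM2l// primitive_le.
have KE : K = expR (B q - B p) by rewrite /K /B; congr expR; ring.
move=> s t /andP[ps sq] /andP[pt tq]; rewrite KE.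
have [st|/ltW ts] := leP s t.
  have [h _] := key _ _ ps st tq; apply: (le_trans h); apply: (ler_wpM2r (E0 s)).
  by rewrite ler_expR lerB ?mB.
have [_ h] := key _ _ pt ts sq; apply: (le_trans h); apply: (ler_wpM2r (E0 s)).
by rewrite ler_expR lerB ?mB.
Qed.

Lemma ivp_unique a f L p q u1 v1 u2 v2 s : lebesgue_integrable a -> 0 <= L -> lipschitzian f L ->
  ivp_sol a f p q u1 v1 -> ivp_sol a f p q u2 v2 -> p <= s <= q ->
  u1 s = u2 s -> v1 s = v2 s ->
  forall t, p <= t <= q -> u1 t = u2 t /\ v1 t = v2 t.
Proof.
move=> ia L0 lf s1 s2 psq us vs t ptq.
have pq : p <= q by move/andP: psq => []; lra.
have := ivp_gronwall ia L0 lf pq s1 s2 psq ptq.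
rewrite {2}/dist2 us vs !subrr expr0n /= addr0 mulr0 /dist2 => H.
have h1 := sqr_ge0 (u1 t - u2 t); have h2 := sqr_ge0 (v1 t - v2 t).
split; apply/eqP; rewrite -subr_eq0 -sqrf_eq0; apply/eqP; lra.
Qed.

End InitialValueProblem.

(** * Existence by Picard iteration *)

Section Picard.
Context {R : realType}.
Notation mu := (@lebesgue_measure R).
Implicit Types (p q : R) (a f u v : R -> R).

Lemma div_exp2_small (C e : R) : 0 <= C -> 0 < e -> exists n, C / 2 ^+ n < e.
Proof.
move=> C0 e0; exists (Num.bound (C / e)).
rewrite ltr_pdivrMr ?exprn_gt0// mulrC -ltr_pdivrMr//.
have Ce : 0 <= C / e by rewrite divr_ge0// ltW.
apply: (lt_le_trans (archi_boundP Ce)).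
by rewrite -natrX ler_nat ltnW// ltn_expl.
Qed.

Lemma le_div_exp2_0 (x C : R) : 0 <= C -> (forall n, `|x| <= C / 2 ^+ n) -> x = 0.
Proof.
move=> C0 H; apply/normr0_eq0/eqP; rewrite eq_le normr_ge0 andbT.
apply/ler_addgt0Pr => e e0; rewrite add0r.
by have [n /ltW] := div_exp2_small C0 e0; apply: le_trans.
Qed.

(* The intervals [s n - 2 C / 2 ^ n, s n + 2 C / 2 ^ n] are nested. *)
Lemma geometric_limit (s : nat -> R) (C : R) : 0 <= C ->
  (forall n, `|s n.+1 - s n| <= C / 2 ^+ n) ->
  exists l, forall n, `|l - s n| <= 2 * C / 2 ^+ n.
Proof.
move=> C0 H; pose r n : R := C / 2 ^+ n.
have r0 n : 0 <= r n by rewrite divr_ge0// exprn_ge0.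
have rS n : r n = 2 * r n.+1.
  by rewrite /r exprS; field; rewrite expf_neq0.
have lo m n : (m <= n)%N -> s m - 2 * r m <= s n - 2 * r n /\ s n + 2 * r n <= s m + 2 * r m.
  move/subnK <-; elim: (n - m)%N => [|k [IH1 IH2]]; first by rewrite add0n.
  rewrite addSn; have := H (k + m)%N; rewrite -/(r _) ler_norml => /andP[h1 h2].
  by have := rS (k + m)%N; have := r0 (k + m)%N; lra.
pose S := [set s n - 2 * r n | n in [set: nat]].
have ubS m : ubound S (s m + 2 * r m).
  move=> _ [n _ <-]; have [mn|/ltnW nm] := leqP m n.
    by have [_ h] := lo _ _ mn; have := r0 n; lra.
  by have [h _] := lo _ _ nm; have := r0 m; lra.
exists (sup S) => n; rewrite -mulrA -/(r n) ler_norml; apply/andP; split.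
  rewrite lerBrDl; apply: (ub_le_sup (ex_intro _ _ (ubS 0%N))).
  by exists n.
by rewrite lerBlDl; apply: ge_sup; [exists (s 0%N - 2 * r 0%N), 0%N|exact: ubS].
Qed.

Definition clamp p q x : R := Num.max p (Num.min x q).

Lemma clampE p q x : p <= x <= q -> clamp p q x = x.
Proof. by move=> /andP[px xq]; rewrite /clamp (min_idPl xq) (max_idPr px). Qed.

Lemma clamp_itv p q x : p <= q -> p <= clamp p q x <= q.
Proof. by move=> pq; rewrite /clamp le_max lexx /= ge_max pq ge_min lexx orbT. Qed.

Lemma max_lip p x y : `|Num.max p x - Num.max p y| <= `|x - y|.
Proof.
have := ler_norm (x - y); have := ler_norm (y - x); rewrite (distrC y).
rewrite ler_norml !maxEle.
by do 2 (case: ifPn; rewrite -?ltNge => ?); move=> *; apply/andP; split; lra.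
Qed.

Lemma min_lip p x y : `|Num.min x p - Num.min y p| <= `|x - y|.
Proof.
have := ler_norm (x - y); have := ler_norm (y - x); rewrite (distrC y).
rewrite ler_norml !minEle.
by do 2 (case: ifPn; rewrite -?ltNge => ?); move=> *; apply/andP; split; lra.
Qed.

Lemma clamp_lip p q x y : `|clamp p q x - clamp p q y| <= `|x - y|.
Proof. exact: le_trans (max_lip _ _ _) (min_lip _ _ _). Qed.

Lemma lipschitzian_continuous f L : 0 <= L -> lipschitzian f L -> continuous f.
Proof.
move=> L0 lf x; apply/cvgrPdist_le => e e0; apply/nbhs_ballP.
exists (e / (L + 1)); first by rewrite /= divr_gt0//; lra.
move=> y; rewrite /ball /= ltr_pdivlMr; last lra.
move=> xy; apply: (le_trans (lf _ _)); have := normr_ge0 (x - y); nra.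
Qed.

Lemma clamp_continuous p q : continuous (clamp p q).
Proof.
by apply: (@lipschitzian_continuous _ 1) => // s t; rewrite mul1r clamp_lip.
Qed.

(** Composing h with [clamp p q] changes the product nowhere, as [a] vanishes off [p, q], and turns
    h into a bounded function continuous on the whole line. *)
Lemma lebesgue_integrable_mul p q a h : p <= q -> lebesgue_integrable a ->
  (forall x, ~~ (p <= x <= q) -> a x = 0) -> {within `[p, q], continuous h} ->
  lebesgue_integrable (fun x => a x * h x).
Proof.
move=> pq ia a0 ch.
have [M M0 HM] := within_continuous_bounded pq ch.
pose h1 x := h (clamp p q x).
have -> : (fun x => a x * h x) = (fun x => a x * h1 x).
  apply/funext => x; have [xpq|/a0 ->] := boolP (p <= x <= q).
    by rewrite /h1 clampE.
  by rewrite !mul0r.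
have ch1 : continuous h1.
  move=> x; apply/cvgrPdist_lt => e e0; apply/nbhs_ballP.
  move/within_continuousE : ch => /(_ (clamp p q x)).
  rewrite /= in_itv /= clamp_itv// => /(_ isT e e0)[r r0 Hr].
  exists r => // y; rewrite /ball /= => xy; rewrite distrC; apply: Hr.
    by rewrite /= in_itv /= clamp_itv.
  by apply: le_lt_trans xy; rewrite distrC clamp_lip.
apply: (@integrableMl _ _ _ mu setT measurableT (EFin \o a) h1) => //.
  exact: measurable_realfun.continuous_measurable_fun.
exists M; split; first exact: num_real.
move=> M' MM' x _; apply: le_trans (ltW MM'); apply: HM.
exact: clamp_itv.
Qed.

Lemma lebesgue_integrable_indic p q : lebesgue_integrable (\1_`[p, q] : R -> R).
Proof. exact: integrable_indic_itv. Qed.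

Lemma cut_continuous p q v : p <= q -> continuous v ->
  lebesgue_integrable (fun x => \1_`[p, q] x * v x).
Proof.
move=> pq cv; apply: (lebesgue_integrable_mul pq (lebesgue_integrable_indic p q)).
  by move=> x xpq; rewrite indicE mem_setE in_itv /= (negbTE xpq).
exact: continuous_subspaceT.
Qed.

Lemma is_derive_primitive_cut p q v x : p < x < q -> continuous v ->
  is_derive x 1 (primitive (fun x => \1_`[p, q] x * v x)) (v x).
Proof.
move=> /andP[px xq] cv; have pq : p <= q by lra.
have ih := cut_continuous pq cv.
pose h x := \1_`[p, q] x * v x.
have hx : h x = v x by rewrite /h indicE mem_setE in_itv /= !ltW ?mul1r.
have ch : {for x, continuous h}.
  suff : h @ x --> v x by rewrite -hx.
  apply: cvg_trans (cv x); apply: near_eq_cvg.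
  apply/nbhs_ballP; exists (Num.min (x - p) (q - x)).
    by rewrite /= lt_min; apply/andP; split; lra.
  move=> y; rewrite /ball /= lt_min !ltr_norml => /andP[/andP[? ?] /andP[? ?]].
  rewrite /h indicE mem_setE in_itv /=.
  by have -> : p <= y <= q; [lra|rewrite mul1r].
have xx1 : x < x + 1 by rewrite ltrDl.
have mh : mu.-integrable `]-oo, x + 1] (EFin \o h) by exact: lebesgue_integrableS.
have [dF] := continuous_FTC1 xx1 mh (ltNyr _) ch.
by rewrite hx derive1E => E; rewrite -[v x]E; exact: DeriveDef.
Qed.

End Picard.

Section PicardIteration.
Context {R : realType} (T L c d : R) (a f : R -> R)
  (T0 : 0 < T) (L0 : 0 < L) (ia : lebesgue_integrable a)
  (a0 : forall x, ~~ (0 <= x <= T) -> a x = 0) (lf : lipschitzian f L).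
Notation mu := (@lebesgue_measure R).
Implicit Types u : R -> R.

Definition picard_v u x :=
  d - (primitive (fun t => a t * f (u t)) x - primitive (fun t => a t * f (u t)) 0).

(** The indicator makes the integrand integrable on the line. The margin of 1 on each side gives
    [picard_u u] a two-sided derivative at 0 and T as well. *)
Definition picard_u u x :=
  let h t := \1_`[(-1), T + 1] t * picard_v u t in
  c + (primitive h x - primitive h 0).

Let lebesgue_integrable_af u : continuous u -> lebesgue_integrable (fun t => a t * f (u t)).
Proof.
move=> cu; apply: (lebesgue_integrable_mul (ltW T0) ia a0); apply: continuous_subspaceT => x.
apply: continuous_comp; first exact: cu.
exact: (lipschitzian_continuous (ltW L0) lf).
Qed.

Lemma picard_v_continuous u : continuous u -> continuous (picard_v u).
Proof.
move=> cu x; apply: cvgB; first exact: cvg_cst.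
by apply: cvgB; [exact: primitive_continuous (lebesgue_integrable_af cu) x|exact: cvg_cst].
Qed.

Lemma picard_u_continuous u : continuous u -> continuous (picard_u u).
Proof.
move=> cu x; apply: cvgD; first exact: cvg_cst.
apply: cvgB; last exact: cvg_cst.
apply: primitive_continuous x; apply: cut_continuous; first by have := T0; lra.
exact: picard_v_continuous.
Qed.

Lemma picard_u_derive u x : continuous u -> 0 <= x <= T ->
  is_derive x 1 (picard_u u) (picard_v u x).
Proof.
move=> cu x0T.
have H : is_derive x 1 (primitive (fun t => \1_`[(-1), T + 1] t * picard_v u t)) (picard_v u x).
  by apply: is_derive_primitive_cut; [lra|exact: picard_v_continuous].
have -> : picard_v u x = 0 + (picard_v u x - 0) by rewrite subr0 add0r.
by apply: is_deriveD.
Qed.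

Lemma picard_C1 u : continuous u -> C1_in `[0, T] (picard_u u) (picard_v u).
Proof.
move=> cu; split; last exact: continuous_subspaceT (picard_v_continuous cu).
move=> x; rewrite /= in_itv /= => x0T; apply: is_derive_has_deriv_in.
exact: picard_u_derive.
Qed.

Lemma picard_v_ac p q u : p <= q -> continuous u ->
  ac_primitive p q (picard_v u) (fun x => - (a x * f (u x))).
Proof.
move=> pq cu.
have := ac_primitiveB pq (ac_primitive_cst p q d)
  (ac_primitiveB pq (primitive_ac p q (lebesgue_integrable_af cu)) (ac_primitive_cst p q
  (primitive (fun t => a t * f (u t)) 0))).
by apply: eq_ac_primitive; apply: aeW => x _; rewrite subr0 sub0r.
Qed.

Let A x := primitive (fun t => `|a t|) x - primitive (fun t => `|a t|) 0.
(** Weight of a Bielecki norm: measured relative to [w], the Picard map halves distances however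
    large T, L and the mass of [a] are. *)
Let w x := expR (2 * T * L * A x).

Let A_ge0 x : 0 <= x -> 0 <= A x.
Proof. by move=> x0; rewrite subr_ge0 primitive_le//; exact: lebesgue_integrable_normr. Qed.

Let w_ge1 x : 0 <= x -> 1 <= w x.
Proof.
move=> x0; rewrite -expR0 ler_expR; apply: mulr_ge0; last exact: A_ge0.
by rewrite !mulr_ge0 ?ltW.
Qed.

Let w_le x y : x <= y -> w x <= w y.
Proof.
move=> xy; rewrite ler_expR; apply: ler_wpM2l; first by rewrite !mulr_ge0 ?ltW.
by rewrite lerD2r primitive_le//; exact: lebesgue_integrable_normr.
Qed.

Lemma picard_u0 u : picard_u u 0 = c.
Proof. by rewrite /picard_u subrr addr0. Qed.

Lemma picard_v0 u : picard_v u 0 = d.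
Proof. by rewrite /picard_v subrr subr0. Qed.

Local Opaque picard_u picard_v primitive.

(** The derivative of the difference of the [picard_v] is at most L |a| M w, which is M / (2 T)
    times w' because w' = 2 T L |a| w. Hence that difference is at most M / (2 T) * w, and the mean
    value theorem contributes a factor of at most T. *)
Lemma picard_contraction u1 u2 (M : R) : continuous u1 -> continuous u2 ->
  (forall x, 0 <= x <= T -> `|u1 x - u2 x| <= M * w x) ->
  forall x, 0 <= x <= T -> `|picard_u u1 x - picard_u u2 x| <= M / 2 * w x.
Proof.
move=> c1 c2 H.
have M0 : 0 <= M.
  have := H 0; rewrite lexx ltW// => /(_ isT)/(le_trans (normr_ge0 _)).
  by rewrite pmulr_lge0// expR_gt0.
have dV u3 u4 x : continuous u3 -> continuous u4 ->
    (forall x, 0 <= x <= T -> `|u3 x - u4 x| <= M * w x) -> 0 <= x <= T ->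
    picard_v u3 x - picard_v u4 x <= M / (2 * T) * w x.
  move=> c3 c4 H3 /andP[x0 xT].
  have dA := ac_primitiveB x0 (primitive_ac 0 x (lebesgue_integrable_normr ia))
    (ac_primitive_cst 0 x (primitive (fun t => `|a t|) 0)).
  have dw := ac_primitive_expR x0 (ac_primitiveZ (2 * T * L) x0 dA).
  have := ac_primitiveB x0 (ac_primitiveB x0 (picard_v_ac x0 c3) (picard_v_ac x0 c4))
    (ac_primitiveZ (M / (2 * T)) x0 dw).
  move=> /(ac_primitive_le x0); rewrite !picard_v0 subrr sub0r -/(w x) -/(w 0).
  have -> : w 0 = 1 by rewrite /w /A subrr mulr0 expR0.
  move=> H4; rewrite -subr_le0; apply: le_trans (_ : _ <= - (M / (2 * T) * 1)) _; last first.
    by rewrite mulr1 oppr_le0 divr_ge0// mulr_ge0// ltW.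
  apply: H4; apply: aeW => y; rewrite in_itv /= => /andP[y0 yx].
  rewrite subr0 -/(w y).
  have y0T : 0 <= y <= T by lra.
  have h1 : `|f (u3 y) - f (u4 y)| <= L * (M * w y).
    by apply: (le_trans (lf _ _)); rewrite ler_pM2l// H3.
  have -> : M / (2 * T) * (w y * (2 * T * L * `|a y|)) = `|a y| * (L * (M * w y)).
    by field; rewrite gt_eqF.
  have h2 : `|a y * (f (u3 y) - f (u4 y))| <= `|a y| * (L * (M * w y)).
    by rewrite normrM ler_wpM2l.
  by have := ler_norm (- (a y * (f (u3 y) - f (u4 y)))); rewrite normrN; lra.
have dV' x : 0 <= x <= T -> `|picard_v u1 x - picard_v u2 x| <= M / (2 * T) * w x.
  move=> x0T; rewrite ler_norml lerNl opprB; apply/andP; split; apply: dV => //.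
  by move=> y yT; rewrite distrC H.
move=> x /andP[x0 xT].
move: x0; rewrite le_eqVlt => /predU1P[<-|x0].
  by rewrite !picard_u0 subrr normr0 mulr_ge0// ?expR_ge0// divr_ge0.
have C1d : C1_in `[0, T] (fun x => picard_u u1 x - picard_u u2 x)
    (fun x => picard_v u1 x - picard_v u2 x).
  split.
    move=> y; rewrite /= in_itv /= => y0T; apply: is_derive_has_deriv_in.
    by apply: is_deriveB; exact: picard_u_derive.
  apply: continuous_subspaceT => y.
  by apply: cvgB; exact: picard_v_continuous.
have [z [z0 zx E]] := C1_in_mvt C1d (lexx 0) x0 xT.
have {E}-> : picard_u u1 x - picard_u u2 x = (picard_v u1 z - picard_v u2 z) * x.
  by move: E; rewrite !picard_u0 (subrr c) (subr0 x) subr0.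
rewrite normrM (gtr0_norm x0).
have zI : 0 <= z <= T by lra.
have MT : 0 <= M / (2 * T) by apply: divr_ge0 => //; rewrite mulr_ge0// ltW.
apply: (@le_trans _ _ (M / (2 * T) * w x * T)).
  apply: ler_pM => //; first exact: ltW.
  exact: le_trans (dV' z zI) (ler_wpM2l MT (w_le (ltW zx))).
by rewrite le_eqVlt; apply/orP; left; apply/eqP; field; rewrite gt_eqF.
Qed.

Let iterate n := iter n picard_u (fun=> c).

Let iterate_continuous n : continuous (iterate n).
Proof.
elim: n => [|n IH]; first by move=> x; exact: cvg_cst.
exact: picard_u_continuous.
Qed.

Lemma ivp_exists : exists u v, [/\ ivp_sol a f 0 T u v, u 0 = c & v 0 = d].
Proof.
have T0' := ltW T0.
have [M M0 HM] : exists2 M, 0 < M & forall x, 0 <= x <= T -> `|iterate 1%N x - iterate 0%N x| <= M.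
  apply: within_continuous_bounded => //; apply: continuous_subspaceT => x.
  by apply: cvgB; exact: iterate_continuous.
have step n x : 0 <= x <= T -> `|iterate n.+1 x - iterate n x| <= M / 2 ^+ n * w x.
  elim: n x => [|n IH] x x0T.
    rewrite expr0 divr1; apply: (le_trans (HM x x0T)).
    by apply: ler_peMr; [exact: ltW|apply: w_ge1; lra].
  have -> : M / 2 ^+ n.+1 = M / 2 ^+ n / 2 by rewrite exprSr invfM mulrA.
  exact: (picard_contraction (@iterate_continuous _) (@iterate_continuous _) IH).
have [W wW W0] : exists2 W, forall x, 0 <= x <= T -> w x <= W & 0 < W.
  by exists (w T); [move=> x /andP[_]; exact: w_le|exact: expR_gt0].
have MW0 : 0 <= M * W by rewrite mulr_ge0 ?ltW.
have cl x : 0 <= clamp 0 T x <= T by exact: clamp_itv.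
(* Clamping the argument defines the limit on the whole line, where the Picard operators need
   continuity. *)
have lim x : {l | forall n, `|l - iterate n (clamp 0 T x)| <= 2 * (M * W) / 2 ^+ n}.
  apply: cid; apply: geometric_limit => // n; apply: (le_trans (step n _ (cl x))).
  by rewrite mulrAC ler_wpM2r ?invr_ge0 ?exprn_ge0// ler_wpM2l ?wW// ltW.
pose u x := sval (lim x).
have Hu n x : `|u x - iterate n (clamp 0 T x)| <= 2 * (M * W) / 2 ^+ n.
  by rewrite /u; case: (lim x).
have cu : continuous u.
  move=> x; apply/cvgrPdist_le => e e0.
  have e4 : 0 < e / 4 by rewrite divr_gt0.
  have [n Hn] := div_exp2_small (mulr_ge0 (ler0n _ 2) MW0) e4.
  have ci : continuous (iterate n \o clamp 0 T).
    by move=> y; apply: continuous_comp; [exact: clamp_continuous|exact: iterate_continuous].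
  have e2 : 0 < e / 2 by rewrite divr_gt0.
  have /cvgrPdist_le/(_ _ e2) := ci x; apply: filterS => y /=.
  have := Hu n x; have := Hu n y; rewrite !ler_norml.
  move=> /andP[? ?] /andP[? ?] /andP[? ?]; apply/andP; split; lra.
have fixu x : 0 <= x <= T -> picard_u u x = u x.
  move=> x0T; apply/eqP; rewrite -subr_eq0; apply/eqP.
  pose C := 2 * (M * W) * W + 2 * (M * W).
  have C0 : 0 <= C by rewrite addr_ge0// mulr_ge0// ?mulr_ge0// ltW.
  apply: (le_div_exp2_0 C0) => n.
  have h1 := Hu n.+1 x; rewrite clampE// in h1.
  have h2 : `|picard_u u x - iterate n.+1 x| <= 2 * (M * W) / 2 ^+ n / 2 * w x.
    apply: (picard_contraction cu (@iterate_continuous n)) => // y y0T.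
    apply: (@le_trans _ _ (2 * (M * W) / 2 ^+ n)).
      by have := Hu n y; rewrite clampE.
    apply: ler_peMr; last by apply: w_ge1; lra.
    by rewrite divr_ge0 ?exprn_ge0// mulr_ge0.
  have n0 : 0 < (2 : R) ^+ n by rewrite exprn_gt0.
  have h3 : 2 * (M * W) / 2 ^+ n.+1 <= 2 * (M * W) / 2 ^+ n.
    apply: ler_wpM2l; first by rewrite mulr_ge0.
    by rewrite lef_pV2 ?posrE ?exprn_gt0// exprS; lra.
  have h4 : 2 * (M * W) / 2 ^+ n / 2 * w x <= 2 * (M * W) * W / 2 ^+ n.
    have := wW x x0T; have h5 : 0 <= 2 * (M * W) / 2 ^+ n.
      by apply: divr_ge0; [rewrite mulr_ge0|exact: ltW].
    have h6 : 2 * (M * W) * W / 2 ^+ n = 2 * (M * W) / 2 ^+ n * W by rewrite mulrAC.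
    have := expR_gt0 (2 * T * L * A x); rewrite -/(w x) h6; nra.
  have E : picard_u u x - u x = (picard_u u x - iterate n.+1 x) - (u x - iterate n.+1 x) by ring.
  rewrite E (le_trans (ler_normB _ _))// /C mulrDl; lra.
(* [picard_u u] is returned instead of [u]: the two agree on [0, T], and the former comes with its
   derivative. *)
exists (picard_u u), (picard_v u); split; last 2 first.
- exact: picard_u0.
- exact: picard_v0.
split; first exact: picard_C1.
apply: eq_ac_primitive (picard_v_ac T0' cu); apply: aeW => x.
by rewrite in_itv /= => /andP[x0 xT]; rewrite fixu ?ltW.
Qed.

End PicardIteration.

(** * Qualitative properties of solutions *)

Section Crossing.
Context {R : realType}.
Implicit Types (p q : R) (u v : R -> R).

(** Either alternative at p makes u positive just to the right of p, so the infimum of the later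
    points with u <= 0 stays away from p; by continuity u vanishes there. *)
Lemma first_crossing p q u v t : C1_in `[p, q] u v ->
  0 < u p \/ u p = 0 /\ 0 < v p -> p < t <= q -> u t <= 0 ->
  exists t0, [/\ p < t0 <= t, u t0 = 0 & forall x, p < x < t0 -> 0 < u x].
Proof.
move=> C1 hp /andP[pt tq] ut.
have pq : p <= q by lra.
have cu := C1_in_continuous C1; move/within_continuousE : (cu) => cuE.
have inI x : p <= x <= q -> `[p, q]%classic x by rewrite /= in_itv.
have [r r0 Hr] : exists2 r, 0 < r & forall x, p < x -> x <= q -> x < p + r -> 0 < u x.
  case: hp => [up|[up vp]].
    have [|r r0 Hr] := cuE p _ _ up; first by apply: inI; rewrite lexx.
    exists r => // x px xq xr; have := Hr x.
    rewrite gtr0_norm ?subr_gt0// ltr_norml => H.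
    by have /andP[] := H (inI x ltac:(lra)) ltac:(lra); lra.
  have /has_deriv_inE H := C1.1 p (inI p ltac:(lra)).
  have [|r r0 Hr] := H (v p / 2); first by rewrite divr_gt0.
  exists r => // x px xq xr; have := Hr x (inI x ltac:(lra)).
  rewrite gtr0_norm ?subr_gt0// up subr0 ler_norml => H1.
  by have /andP[h1 _] := H1 ltac:(lra); nra.
pose S := [set x | p < x <= t /\ u x <= 0].
have St : S t by rewrite /S /= pt lexx.
have lbS : lbound S (p + r).
  move=> x [/andP[px xt] ux]; rewrite leNgt; apply/negP => xr.
  by have := Hr x px; lra.
have hS : has_inf S by split; [exists t|exists (p + r)].
have t1 : p + r <= inf S by apply: lb_le_inf => //; exists t.
have t2 : inf S <= t by apply: ge_inf => //; exists (p + r).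
have pos x : p < x < inf S -> 0 < u x.
  move=> /andP[px xi]; rewrite ltNge; apply/negP => ux.
  have : inf S <= x; last lra.
  by apply: ge_inf; [exists (p + r)|split => //; apply/andP; split; lra].
have iI : `[p, q]%classic (inf S) by apply: inI; lra.
exists (inf S); split => //; first lra.
apply/eqP; rewrite eq_le; apply/andP; split.
  rewrite leNgt; apply/negP => u0.
  have [s s0 Hs] := cuE _ iI _ u0.
  have [x [/andP[px xt] ux] xs] := inf_adherent s0 hS.
  have ix : inf S <= x by apply: ge_inf; [exists (p + r)|split => //; apply/andP].
  have := Hs x (inI x ltac:(lra)); rewrite ger0_norm ?subr_ge0// ltr_norml => H.
  by have /andP[] := H ltac:(lra); lra.
rewrite leNgt; apply/negP => u0.
have u0' : 0 < - u (inf S) by lra.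
have [s s0 Hs] := cuE _ iI _ u0'.
pose x := Num.max (p + r / 2) (inf S - s / 2).
have x1 : p + r / 2 <= x by rewrite le_max lexx.
have x2 : inf S - s / 2 <= x by rewrite le_max lexx orbT.
have x3 : x < inf S by rewrite gt_max; apply/andP; split; lra.
have := Hs x (inI x ltac:(lra)); rewrite ltr0_norm ?subr_lt0// ltr_norml => H.
have /andP[_ h] := H ltac:(lra).
by have := pos x ltac:(lra); lra.
Qed.

Lemma last_crossing p q u v t : C1_in `[p, q] u v -> 0 < u q -> p <= t < q ->
  u t <= 0 -> exists t0, [/\ t <= t0 < q, u t0 = 0 & forall x, t0 < x < q -> 0 < u x].
Proof.
move=> C1 uq /andP[pt tq] ut.
have [||||t0 [/andP[h1 h2] h3 h4]] := @first_crossing (- q) (- p) (fun x => u (- x))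
    (fun x => - v (- x)) (- t).
- exact: C1_in_reflect.
- by left; rewrite opprK.
- by rewrite ltrN2 lerN2 tq.
- by rewrite opprK.
exists (- t0); split => //; first lra.
by move=> x hx; rewrite -[x]opprK; apply: h4; lra.
Qed.

End Crossing.

Section Qualitative.
Context {R : realType} (T L : R) (a f : R -> R).
Context (T0 : 0 < T) (L0 : 0 < L) (ia : lebesgue_integrable a).
Context (lf : lipschitzian f L) (fN : forall s, s <= 0 -> f s = 0).
Notation mu := (@lebesgue_measure R).
Implicit Types (u v : R -> R).

Let Pa := primitive (fun t => `|a t|).
Definition total_mass := Pa T - Pa 0.

Lemma total_mass_ge0 : 0 <= total_mass.
Proof. by rewrite subr_ge0 primitive_le// ?ltW//; exact: lebesgue_integrable_normr. Qed.

Lemma ivp_v_bound u v G s t : ivp_sol a f 0 T u v -> 0 <= s -> s <= t -> t <= T ->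
  (forall x, s <= x <= t -> `|f (u x)| <= G) -> `|v t - v s| <= G * (Pa t - Pa s).
Proof.
move=> sol s0 st tT HG.
have [_ dv] := ivp_solS s0 tT sol.
have dP := ac_primitiveZ G st (primitive_ac s t (lebesgue_integrable_normr ia)).
have aeG (P : R -> Prop) : (forall x, s <= x <= t -> P x) ->
    {ae mu, forall x, x \in `]s, t[ -> P x}.
  by move=> H; apply: aeW => x; rewrite in_itv /= => /andP[? ?]; apply: H; rewrite !ltW.
have bnd x : s <= x <= t -> `|a x * f (u x)| <= G * `|a x|.
  by move=> xst; rewrite normrM mulrC ler_wpM2r// HG.
rewrite ler_norml; apply/andP; split.
  have := ac_primitive_ge st (ac_primitiveD dv dP) => H.
  suff : v s + G * Pa s <= v t + G * Pa t by lra.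
  apply: H; apply: aeG => x /bnd; rewrite ler_norml => /andP[]; lra.
have := ac_primitive_le st (ac_primitiveB st dv dP) => H.
suff : v t - G * Pa t <= v s - G * Pa s by lra.
apply: H; apply: aeG => x /bnd; rewrite ler_norml => /andP[]; lra.
Qed.

Lemma ivp_v_total u v G : ivp_sol a f 0 T u v ->
  (forall x, 0 <= x <= T -> `|f (u x)| <= G) ->
  forall s t, 0 <= s <= T -> 0 <= t <= T -> `|v t - v s| <= G * total_mass.
Proof.
move=> sol HG s t.
have h0 : 0 <= (0 : R) <= T by rewrite lexx ltW.
have G0 : 0 <= G := le_trans (normr_ge0 _) (HG 0 h0).
have mP x y : x <= y -> Pa x <= Pa y by apply: primitive_le => //; exact: lebesgue_integrable_normr.
wlog st : s t / s <= t => [H hs ht|].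
  have [st|/ltW ts] := leP s t; first exact: H.
  by rewrite distrC; exact: H.
move=> /andP[s0 sT] /andP[t0 tT].
apply: (le_trans (ivp_v_bound sol s0 st tT _)).
  by move=> x xst; apply: HG; lra.
by rewrite ler_wpM2l// lerB ?mP.
Qed.

Lemma ivp_sol0 p q : ivp_sol a f p q (fun=> 0) (fun=> 0).
Proof.
split.
  split; last exact: continuous_subspaceT (fun x => @cst_continuous _ _ _ _).
  by move=> x _; apply: is_derive_has_deriv_in; exact: is_derive_cst.
apply: eq_ac_primitive (ac_primitive_cst p q 0); apply: aeW => x _.
by rewrite fN// mulr0 oppr0.
Qed.

(* Past its first zero, which is transversal by uniqueness, u is linear because f
   vanishes on (-oo, 0]. *)
Lemma ivp_crossing u v t : ivp_sol a f 0 T u v -> 0 <= u 0 ->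
  0 < u 0 \/ 0 < v 0 -> 0 < t <= T -> u t <= 0 -> u T <= 0 /\ v T < 0.
Proof.
move=> sol c0 cd t0T ut.
have H0 : 0 < u 0 \/ u 0 = 0 /\ 0 < v 0.
  by move: c0; rewrite le_eqVlt => /predU1P[E|]; [right|left]; rewrite -?E;
     case: cd => //; rewrite -E ltxx.
have [t1 [/andP[t10 t1t] ut1 pos]] := first_crossing sol.1 H0 t0T ut.
have t1T : t1 <= T by lra.
have vt1 : v t1 <= 0.
  apply: (C1_in_right_end t10 (ivp_solS (lexx 0) t1T sol).1) => x xt.
  by rewrite ut1 ltW ?pos.
have vt1' : v t1 < 0.
  rewrite lt_neqAle vt1 andbT; apply/eqP => v0.
  have t1I : 0 <= t1 <= T by lra.
  have U := ivp_unique ia (ltW L0) lf sol (ivp_sol0 0 T) t1I ut1 v0.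
  have [|c00 d00] := U 0; first by rewrite lexx ltW.
  by case: cd; lra.
have lin : ivp_sol a f t1 T (fun x => v t1 * (x - t1)) (fun=> v t1).
  split.
    split; last exact: continuous_subspaceT (fun x => @cst_continuous _ _ _ _).
    move=> x _; apply/has_deriv_inE => e e0; exists 1 => // y _ _.
    have -> : v t1 * (y - t1) - v t1 * (x - t1) - v t1 * (y - x) = 0 by ring.
    by rewrite normr0 mulr_ge0// ltW.
  apply: eq_ac_primitive (ac_primitive_cst t1 T _); apply: aeW => x.
  rewrite in_itv /= => /andP[x1 x2]; rewrite fN ?mulr0 ?oppr0//; nra.
have t1I : t1 <= t1 <= T by rewrite lexx.
have ut1' : u t1 = v t1 * (t1 - t1) by rewrite ut1 subrr mulr0.
have U := ivp_unique ia (ltW L0) lf (ivp_solS (ltW t10) (lexx T) sol) lin t1I ut1' erefl.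
have [|-> ->] := U T; first by rewrite lexx andbT.
by split => //; nra.
Qed.

Lemma ivp_u_pos u v : ivp_sol a f 0 T u v -> 0 <= u 0 -> 0 < u 0 \/ 0 < v 0 ->
  0 < u T -> forall x, 0 < x <= T -> 0 < u x.
Proof.
move=> sol c0 cd uT x x0T; rewrite ltNge; apply/negP => ux.
by have [] := ivp_crossing sol c0 cd x0T ux; lra.
Qed.

(** As long as 0 <= u <= u 0, |f (u)| <= L u 0, so the slope gains at most L u 0 times the mass of
    [a] and stays at or below - u 0. Thus u cannot climb back to its initial value. *)
Lemma ivp_steep u v : ivp_sol a f 0 T u v -> 0 < u 0 ->
  v 0 = - (L * total_mass + 1) * u 0 -> u T < u 0.
Proof.
move=> sol c0 v0; rewrite ltNge; apply/negP => uT.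
have m0 := total_mass_ge0.
have pos x : 0 < x <= T -> 0 < u x.
  by apply: (ivp_u_pos sol (ltW c0)); [left|lra].
have C1 := C1_in_opp (C1_in_subcst (u 0) sol.1).
have [|||t0 [/andP[t00 t0T] ut0 lt]] := @first_crossing _ 0 T _ _ T C1.
- right; rewrite subrr oppr0; split => //; rewrite v0.
  by have := mulr_ge0 (mulr_ge0 (ltW L0) m0) (ltW c0); lra.
- by rewrite T0 lexx.
- by lra.
have sol' := ivp_solS (lexx 0) t0T sol.
have ub x : 0 <= x <= t0 -> 0 <= u x <= u 0.
  move=> /andP[]; rewrite le_eqVlt => /predU1P[<- _|x0]; first by rewrite lexx ltW.
  rewrite le_eqVlt => /predU1P[->|xt]; first by lra.
  by have := lt x ltac:(lra); have := pos x ltac:(lra); lra.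
have fb x : 0 <= x <= t0 -> `|f (u x)| <= L * u 0.
  move=> /ub ux; have -> : f (u x) = f (u x) - f 0 by rewrite (fN (lexx 0)) subr0.
  apply: (le_trans (lf _ _)); move/andP : ux => [ux1 ux2].
  by rewrite subr0 ler_pM2l// ger0_norm.
have [z [z0 zt E]] := C1_in_mvt sol'.1 (lexx 0) t00 (lexx t0).
have mP x y : x <= y -> Pa x <= Pa y by apply: primitive_le => //; exact: lebesgue_integrable_normr.
have := @ivp_v_bound _ _ (L * u 0) 0 z sol (lexx 0) (ltW z0) ltac:(lra).
move=> /(_ (fun x hx => fb x ltac:(lra))); rewrite ler_norml => /andP[_ h].
have h2 : L * u 0 * (Pa z - Pa 0) <= L * u 0 * total_mass.
  apply: ler_wpM2l; first by rewrite mulr_ge0// ltW.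
  by rewrite /total_mass lerD2r mP//; lra.
have vz : v z < 0 by rewrite v0 in h; lra.
have : 0 < - v z * (t0 - 0) by rewrite mulr_gt0//; lra.
by lra.
Qed.

End Qualitative.

(** * Dependence on initial data and small solutions *)

Section SmallData.
Context {R : realType} (T L : R) (a f : R -> R).
Context (T0 : 0 < T) (L0 : 0 < L) (ia : lebesgue_integrable a).
Context (lf : lipschitzian f L) (fN : forall s, s <= 0 -> f s = 0).
Notation mu := (@lebesgue_measure R).
Notation m := (total_mass T a).
Implicit Types (u v : R -> R).

Definition growth_const := expR (T + L * m).

Lemma growth_const_ge1 : 1 <= growth_const.
Proof.
rewrite -expR0 ler_expR; apply: addr_ge0; first exact: ltW.
by apply: mulr_ge0; [exact: ltW|exact: (total_mass_ge0 T0 ia)].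
Qed.

(** Gronwall bounds squared distances by the factor K = [growth_const]. As K >= 1 gives K <= K ^ 2,
    the same K bounds the distances themselves. *)
Lemma ivp_lip u1 v1 u2 v2 : ivp_sol a f 0 T u1 v1 -> ivp_sol a f 0 T u2 v2 ->
  forall s x, 0 <= s <= T -> 0 <= x <= T ->
  `|u1 x - u2 x| <= growth_const * (`|u1 s - u2 s| + `|v1 s - v2 s|) /\
  `|v1 x - v2 x| <= growth_const * (`|u1 s - u2 s| + `|v1 s - v2 s|).
Proof.
move=> s1 s2 s x s0T x0T.
have := ivp_gronwall ia (ltW L0) lf (ltW T0) s1 s2 s0T x0T.
rewrite subr0 -/(total_mass T a) -/growth_const /dist2.
have K1 := growth_const_ge1.
set U := u1 x - u2 x; set V := v1 x - v2 x.
set C := u1 s - u2 s; set D := v1 s - v2 s.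
rewrite -(real_normK (num_real U)) -(real_normK (num_real V)).
rewrite -(real_normK (num_real C)) -(real_normK (num_real D)).
have := normr_ge0 U; have := normr_ge0 V; have := normr_ge0 C; have := normr_ge0 D.
move: `|U| `|V| `|C| `|D| growth_const K1 => {}U {}V {}C {}D K K1 D0 C0 V0 U0 H.
have S0 : 0 <= K * (C + D) by rewrite mulr_ge0 ?addr_ge0//; lra.
have H1 : U ^+ 2 + V ^+ 2 <= (K * (C + D)) ^+ 2.
  apply: (le_trans H).
  have h1 : C ^+ 2 + D ^+ 2 <= (C + D) ^+ 2 by have := mulr_ge0 C0 D0; nra.
  have h2 : K <= K ^+ 2 by nra.
  rewrite exprMn; apply: ler_pM => //; first lra.
  by rewrite addr_ge0 ?sqr_ge0.
have := sqr_ge0 U; have := sqr_ge0 V => V2 U2.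
by split; rewrite -(@ler_pXn2r _ 2%N)// ?nnegrE//; lra.
Qed.

Lemma ivp_small u v : ivp_sol a f 0 T u v ->
  forall s x, 0 <= s <= T -> 0 <= x <= T ->
  `|u x| <= growth_const * (`|u s| + `|v s|) /\
  `|v x| <= growth_const * (`|u s| + `|v s|).
Proof.
move=> sol s x s0T x0T.
by have := ivp_lip sol (ivp_sol0 a fN 0 T) s0T x0T; rewrite !subr0.
Qed.

(** Small solutions are nearly affine. With S = max |u|, the slope varies by at most e S m, so u
    differs from u 0 + v 0 x by at most T e m S <= S / 4. Hence S <= 4/3 (u 0 + v 0 T), and the
    error is at most a third of u 0 + v 0 T. *)
Lemma ivp_small_f u v r e : 0 <= e -> ivp_sol a f 0 T u v ->
  (forall s, `|s| <= r -> `|f s| <= e * `|s|) -> 4 * T * e * m <= 1 ->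
  (forall x, 0 <= x <= T -> `|u x| <= r) -> 0 <= u 0 -> 0 <= v 0 ->
  forall x, 0 <= x <= T -> `|u x - (u 0 + v 0 * x)| <= (u 0 + v 0 * T) / 3.
Proof.
move=> e0 sol fe em ur c0 d0.
have m0 := total_mass_ge0 T0 ia.
have cu : {within `[0, T], continuous (fun x => `|u x|)}.
  move=> x; apply: continuous_comp; last exact: norm_continuous.
  exact: C1_in_continuous sol.1 x.
have [xm xmT Hm] := EVT_max (ltW T0) cu.
rewrite in_itv /= in xmT.
have h0 : 0 <= (0 : R) <= T by rewrite lexx ltW.
have bf x : 0 <= x <= T -> `|f (u x)| <= e * `|u xm|.
  by move=> xT; apply: (le_trans (fe _ (ur x xT))); rewrite ler_wpM2l// Hm// in_itv.
have C1 : C1_in `[0, T] (fun x => u x - v 0 * x) (fun x => v x - v 0).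
  split.
    move=> x xI; apply/has_deriv_inE => s /(proj1 (has_deriv_inE _ _ _ _) (sol.1.1 x xI)).
    move=> [q r0 Hr]; exists q => // y yI yx.
    have -> : u y - v 0 * y - (u x - v 0 * x) - (v x - v 0) * (y - x) =
      u y - u x - v x * (y - x) by ring.
    exact: Hr.
  apply/within_continuousE => x xI s s0.
  have [q r0 Hr] := proj1 (within_continuousE _ _) sol.1.2 x xI s s0.
  by exists q => // y yI yx; rewrite opprB addrA subrK; exact: Hr.
have bv x : 0 <= x <= T -> `|v x - v 0| <= e * `|u xm| * m.
  by move=> xT; exact: (ivp_v_total T0 ia sol bf h0 xT).
have bu x : 0 <= x <= T -> `|u x - (u 0 + v 0 * x)| <= `|u xm| / 4.
  move=> xT; have := C1_in_lip C1 bv xT h0.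
  rewrite mulr0 !subr0 => H.
  have -> : u x - (u 0 + v 0 * x) = u x - v 0 * x - u 0 by ring.
  apply: (le_trans H); move/andP : xT => [x0 xT].
  rewrite (ger0_norm x0).
  have h1 : e * `|u xm| * m * x <= e * `|u xm| * m * T by rewrite ler_wpM2l// !mulr_ge0.
  have h2 : 4 * T * e * m * `|u xm| <= 1 * `|u xm| by rewrite ler_wpM2r.
  lra.
have vT : v 0 * xm <= v 0 * T by rewrite ler_wpM2l//; case/andP: xmT.
have mx : `|u xm| <= 4 / 3 * (u 0 + v 0 * T).
  have h := bu xm xmT; have h1 : 0 <= v 0 * xm by rewrite mulr_ge0//; case/andP: xmT.
  have := ler_normD (u xm - (u 0 + v 0 * xm)) (u 0 + v 0 * xm).
  rewrite subrK (ger0_norm (_ : 0 <= u 0 + v 0 * xm)); lra.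
by move=> x /bu; lra.
Qed.

(* The oscillation of f(u) is small compared with G = max f(u), so that
   v T - v 0 = - \int a f(u) is close to - G \int a. *)
Lemma ivp_v_increases u v r e t0 : 0 <= e -> ivp_sol a f 0 T u v ->
  (forall s, 0 < s -> 0 < f s) -> (forall s, 0 <= f s) ->
  (forall s t, 0 <= s <= r -> 0 <= t <= r -> `|f s - f t| <= e * `|s - t|) ->
  e * T * m ^+ 2 < - (primitive a T - primitive a 0) ->
  (forall x, 0 <= x <= T -> 0 < u x <= r) ->
  0 <= t0 <= T -> v t0 = 0 -> v 0 < v T.
Proof.
move=> e0 sol fpos f0 fe em ur t0T vt0.
have m0 := total_mass_ge0 T0 ia.
have h0 : 0 <= (0 : R) <= T by rewrite lexx ltW.
have hT : 0 <= T <= T by rewrite lexx ltW.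
have cf : {within `[0, T], continuous (fun x => f (u x))}.
  move=> x; apply: continuous_comp; first exact: C1_in_continuous sol.1 x.
  exact: lipschitzian_continuous (ltW L0) lf _.
have [xm xmT Hm] := EVT_max (ltW T0) cf.
rewrite in_itv /= in xmT.
set G := f (u xm) in Hm *.
have G0 : 0 < G by apply: fpos; case/andP : (ur _ xmT).
have bf x : 0 <= x <= T -> `|f (u x)| <= G.
  by move=> xT; rewrite ger0_norm// Hm// in_itv.
have bv x : 0 <= x <= T -> `|v x| <= G * m.
  move=> xT; have := ivp_v_total T0 ia sol bf t0T xT; by rewrite vt0 subr0.
have bd x : 0 <= x <= T -> `|f (u x) - G| <= e * (G * m * T).
  move=> xT; have ux := ur x xT; have um := ur xm xmT.
  apply: (le_trans (fe _ _ _ _)); [lra|lra|].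
  rewrite ler_wpM2l//; apply: (le_trans (C1_in_lip sol.1 bv xT xmT)).
  rewrite ler_wpM2l//; first by rewrite mulr_ge0// ltW.
  by rewrite ler_norml; lra.
set k := e * (G * m * T) in bd.
have k0 : 0 <= k by rewrite !mulr_ge0// ltW.
have T0' := ltW T0.
have H := ac_primitive_ge T0' (ac_primitiveD
  (ac_primitiveD sol.2 (ac_primitiveZ G T0' (primitive_ac 0 T ia)))
  (ac_primitiveZ k T0' (primitive_ac 0 T (lebesgue_integrable_normr ia)))).
have {}H : v 0 + G * primitive a 0 + k * primitive (fun t => `|a t|) 0 <=
    v T + G * primitive a T + k * primitive (fun t => `|a t|) T.
  apply: H; apply: aeW => x; rewrite in_itv /= => /andP[x0 xT].
  have := bd x ltac:(lra).
  have -> : - (a x * f (u x)) + G * a x = - (a x * (f (u x) - G)) by ring.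
  move=> h; have : `|a x * (f (u x) - G)| <= `|a x| * k by rewrite normrM ler_wpM2l.
  by rewrite ler_norml => /andP[]; lra.
have Em : primitive (fun t => `|a t|) T - primitive (fun t => `|a t|) 0 = m by [].
have h1 : G * (e * T * m ^+ 2) < G * - (primitive a T - primitive a 0) by rewrite ltr_pM2l.
have h2 : k * m = G * (e * T * m ^+ 2) by rewrite /k; ring.
have : k * (primitive (fun t => `|a t|) T - primitive (fun t => `|a t|) 0) = k * m by rewrite Em.
lra.
Qed.

End SmallData.

(** * A priori bounds *)

Section NodalBound.
Context {R : realType}.
Notation mu := (@lebesgue_measure R).
Implicit Types (p q : R) (u v : R -> R).

(** The neighbouring zeros on both sides of x0. The signs of v at the ends will settle the boundary
    terms of a Wronskian. *)
Lemma nodal_interval p q u v x0 : C1_in `[p, q] u v -> u p = 0 -> u q = 0 ->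
  p <= x0 <= q -> 0 < u x0 -> exists p' q', [/\ p <= p', p' < q', q' <= q,
    (u p' = 0 /\ u q' = 0) /\ (0 <= v p' /\ v q' <= 0) &
    forall x, p' < x < q' -> 0 < u x].
Proof.
move=> C1 up uq /andP[px xq] ux.
have px' : p < x0 by rewrite lt_neqAle px andbT; apply/eqP => E; move: ux; rewrite -E up ltxx.
have xq' : x0 < q by rewrite lt_neqAle xq andbT; apply/eqP => E; move: ux; rewrite E uq ltxx.
have sub (s t : R) : p <= s -> t <= q -> C1_in `[s, t] u v.
  by move=> ps tq; apply: C1_inS C1 => x /=; rewrite !in_itv /= => /andP[]; lra.
have [|||q' [/andP[xq1 q'q] uq' posr]] := @first_crossing _ x0 q u v q (sub _ _ px (lexx q)).
- by left.
- by rewrite xq' lexx.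
- by rewrite uq.
have [|||p' [/andP[pp' p'x] up' posl]] := @last_crossing _ p x0 u v p (sub _ _ (lexx p) xq).
- by [].
- by rewrite lexx.
- by rewrite up.
have pos x : p' < x < q' -> 0 < u x.
  move=> /andP[h1 h2]; have [xx|xx|->//] := ltgtP x x0.
    by apply: posl; rewrite h1.
  by apply: posr; rewrite xx.
have p'q' : p' < q' by lra.
have C1' := sub _ _ pp' q'q.
exists p', q'; split => //; split => //; split.
- by apply: (C1_in_left_end p'q' C1') => x hx; rewrite up' ltW// pos.
- by apply: (C1_in_right_end p'q' C1') => x hx; rewrite uq' ltW// pos.
Qed.

(** Otherwise the identity would vacuously have a nonpositive derivative a.e. on ]p, q[ and could
    not increase. *)
Lemma ae_false_interval p q : {ae mu, forall x, x \in `]p, q[ -> False} -> q <= p.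
Proof.
move=> H; rewrite leNgt; apply/negP => pq.
suff : idfun q <= idfun p :> R by rewrite /= leNgt pq.
apply: (ac_primitive_le (ltW pq) (ac_primitive_id p q)).
by apply: lebesgue_aeS H => x Hx /Hx.
Qed.

(** If the end values did not increase, the primitive, being nondecreasing, would be constant. Its
    derivative would then be 0 everywhere in ]p, q[ and equal to h > 0 almost everywhere. *)
Lemma primitive_gt0 p q h : p < q -> lebesgue_integrable h ->
  {ae mu, forall x, x \in `]p, q[ -> 0 < h x} -> primitive h p < primitive h q.
Proof.
move=> pq ih hpos; rewrite ltNge; apply/negP => hqp.
have mono s t : p <= s -> s <= t -> t <= q -> primitive h s <= primitive h t.
  move=> ps st tq; apply: (ac_primitive_ge st (primitive_ac s t ih)).
  apply: lebesgue_aeS hpos => x H; rewrite in_itv /= => /andP[? ?].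
  by apply/ltW/H; rewrite in_itv /=; lra.
have cst s : p <= s <= q -> primitive h s = primitive h p.
  move=> /andP[ps sq]; have := mono p s (lexx p) ps sq; have := mono s q ps sq (lexx q); lra.
suff : q <= p by rewrite leNgt pq.
apply: ae_false_interval.
apply: lebesgue_ae2 hpos (primitive_ac p q ih).2 => x hx dx xpq.
have xI := xpq; rewrite in_itv /= in xI; move/andP : xI => [px xq].
have d0 : is_derive x 1 (primitive h) 0.
  apply: is_derive_epsP => e e0; exists (Num.min (x - p) (q - x)).
    by rewrite lt_min; apply/andP; split; lra.
  move=> y; rewrite lt_min !ltr_norml => /andP[/andP[? ?] /andP[? ?]].
  rewrite !cst; [|lra|lra]; rewrite subrr mul0r subrr normr0 mulr_ge0//.
  exact: ltW.
have := hx xpq; have -> : h x = 0; last by rewrite ltxx.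
by case: (dx xpq) => _ <-; case: d0.
Qed.

Lemma lebesgue_integrable_cut p q h : lebesgue_integrable h ->
  lebesgue_integrable (fun x => h x * \1_`[p, q] x).
Proof.
move=> ih; apply: (@integrableMl _ _ _ mu setT measurableT (EFin \o h) (\1_`[p, q])) => //.
exists 1; split; first exact: num_real.
by move=> M M1 x _; rewrite /= indicE ger0_norm// (le_trans _ (ltW M1))// lern1 leq_b1.
Qed.

(** For x <= y the chord from p gives u x >= u y (x - p) / (q - p); for x >= y the chord to q gives
    the factor (q - x) / (q - p). Both factors are at most 1, so their product is one weight valid
    for every y. *)
Lemma concave_lower_bound p q u v : p < q -> C1_in `[p, q] u v ->
  (forall x y, p <= x -> x <= y -> y <= q -> v y <= v x) ->
  (forall x, p <= x <= q -> 0 <= u x) ->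
  forall x y, p <= x <= q -> p <= y <= q ->
  u y * ((x - p) * (q - x) / (q - p) ^+ 2) <= u x.
Proof.
move=> pq C1 vN u0 x y /andP[px xq] /andP[py yq].
have D0 : 0 < q - p by rewrite subr_gt0.
rewrite mulrA ler_pdivrMr ?exprn_gt0//.
have ux := u0 x ltac:(lra); have uy := u0 y ltac:(lra).
have up := u0 p ltac:(lra); have uq := u0 q ltac:(lra).
have x1 : 0 <= x - p by lra.
have x2 : 0 <= q - x by lra.
have alg (r A B w1 w2 : R) : 0 <= r -> 0 <= A -> 0 <= B -> A + B <= q - p ->
    w1 * A <= u x -> r <= u x + w2 * B -> w2 <= w1 -> A * r <= u x * (q - p).
  move=> r0 A0 B0 ABD hA hr hw.
  have h1 : r <= u x + w1 * B by have := ler_wpM2r B0 hw; lra.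
  have h2 : A * r <= A * (u x + w1 * B) by rewrite ler_wpM2l.
  have h3 : w1 * A * B <= u x * B by rewrite ler_wpM2r.
  have h4 : u x * (A + B) <= u x * (q - p) by rewrite ler_wpM2l.
  lra.
have fin A B : 0 <= A -> 0 <= B -> B <= q - p -> A * u y <= u x * (q - p) ->
    u y * (A * B) <= u x * (q - p) ^+ 2.
  move=> A0 B0 BD h.
  have h1 : A * u y * B <= u x * (q - p) * B by rewrite ler_wpM2r.
  have h2 : u x * (q - p) * B <= u x * (q - p) * (q - p).
    by rewrite ler_wpM2l// mulr_ge0// ltW.
  by rewrite expr2; lra.
have [xy|yx|xy] := ltgtP x y; last 1 first.
- apply: fin => //; first lra.
  by rewrite -xy [leRHS]mulrC; apply: ler_wpM2r => //; lra.
- apply: fin => //; first lra.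
  have [z2 [xz2 z2y E2]] := C1_in_mvt C1 px xy yq.
  move: x1; rewrite le_eqVlt => /predU1P[<-|x1']; first by rewrite mul0r mulr_ge0// ltW.
  have px' : p < x by lra.
  have [z1 [pz1 z1x E1]] := C1_in_mvt C1 (lexx p) px' xq.
  apply: (alg (u y) (x - p) (y - x) (v z1) (v z2)) => //; try lra.
  by apply: vN; lra.
rewrite [X in u y * X]mulrC; apply: fin => //; first lra.
have [z2 [xz2 z2y E2]] := C1_in_mvt C1 py yx xq.
move: x2; rewrite le_eqVlt => /predU1P[<-|x2']; first by rewrite mul0r mulr_ge0// ltW.
have xq' : x < q by lra.
have [z1 [pz1 z1x E1]] := C1_in_mvt C1 px xq' (lexx q).
apply: (alg (u y) (q - x) (x - y) (- v z1) (- v z2)) => //; try lra.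
by rewrite lerN2; apply: vN; lra.
Qed.

(* On a nodal interval [p1, q1] of phi > 0 the Wronskian v phi - u phi' does not
   decrease between the endpoints, while its derivative a phi (l u - f(u)) is at
   most a phi (C - (s - l) u); concavity gives u >= u(y) dl for the weight dl.
   The bound M does not depend on f. *)
Lemma nodal_bound (a phi phi' : R -> R) (p q l s C x0 : R) : p < q -> lebesgue_integrable a ->
  l < s -> (forall x, p < x < q -> 0 <= a x) ->
  {ae mu, forall x, x \in `]p, q[ -> 0 < a x} ->
  C1_in `[p, q] phi phi' ->
  ac_primitive p q phi' (fun x => - (l * a x * phi x)) ->
  phi p = 0 -> phi q = 0 -> p <= x0 <= q -> phi x0 != 0 ->
  exists M, forall f u v, (forall t, 0 <= t -> s * t - C <= f t) ->
    (forall t, 0 <= f t) -> ivp_sol a f p q u v ->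
    (forall x, p <= x <= q -> 0 <= u x) -> forall x, p <= x <= q -> u x <= M.
Proof.
move=> pq ia ls a0 apos.
wlog : phi phi' / 0 < phi x0.
  move=> W C1 ac fp fq xI; rewrite neq_lt => /orP[neg|pos]; last first.
    by apply: (W phi phi') => //; rewrite gt_eqF.
  apply: (W (fun x => - phi x) (fun x => - phi' x)); rewrite ?fp ?fq ?oppr0//.
  - by rewrite oppr_gt0.
  - exact: C1_in_opp.
  - apply: eq_ac_primitive (ac_primitiveN (ltW pq) ac).
    by apply: aeW => x _; rewrite mulrN.
  - by rewrite oppr_eq0 lt_eqF.
move=> pos C1 ac fp fq xI _.
have [p1 [q1 [pp1 p1q1 q1q [[fp1 fq1] [dp1 dq1]] posI]]] := nodal_interval C1 fp fq xI pos.
have C1' : C1_in `[p1, q1] phi phi'.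
  by apply: C1_inS C1 => x /=; rewrite !in_itv /= => /andP[]; lra.
have ac' := ac_primitiveS pp1 q1q ac.
pose dl x := (x - p) * (q - x) / (q - p) ^+ 2.
have D0 : 0 < q - p by rewrite subr_gt0.
have cphi := C1_in_continuous C1'.
have cdl : continuous dl.
  move=> x; apply: cvgM; last exact: cvg_cst.
  by apply: cvgM; apply: cvgB => //; exact: cvg_cst.
(* The weight is cut to [p1, q1] so that the products with phi are integrable on the whole line: phi
   is arbitrary outside. *)
have supp x : ~~ (p1 <= x <= q1) -> a x * \1_`[p1, q1] x = 0.
  by move=> h; rewrite indicE mem_setE in_itv /= (negbTE h) mulr0.
have cut x : p1 < x < q1 -> \1_`[p1, q1] x = 1 :> R.
  by move=> /andP[h1 h2]; rewrite indicE mem_setE in_itv /= !ltW.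
pose h2 x := a x * \1_`[p1, q1] x * phi x.
pose h1 x := a x * \1_`[p1, q1] x * (phi x * dl x).
have ih2 : lebesgue_integrable h2.
  exact: (lebesgue_integrable_mul (ltW p1q1) (lebesgue_integrable_cut _ _ ia) supp).
have ih1 : lebesgue_integrable h1.
  apply: (lebesgue_integrable_mul (ltW p1q1) (lebesgue_integrable_cut _ _ ia) supp) => x.
  by apply: continuousM; [exact: cphi|exact: continuous_subspaceT cdl x].
have I1 : primitive h1 p1 < primitive h1 q1.
  apply: primitive_gt0 => //; apply: lebesgue_aeS apos => x ax; rewrite in_itv /= => xpq.
  rewrite /h1 cut// mulr1 mulr_gt0//; first by apply: ax; rewrite in_itv /=; lra.
  by rewrite mulr_gt0 ?posI// divr_gt0 ?exprn_gt0// mulr_gt0//; lra.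
pose i1 := primitive h1 q1 - primitive h1 p1.
pose i2 := primitive h2 q1 - primitive h2 p1.
have i10 : 0 < i1 by rewrite subr_gt0.
(* Comparing the Wronskian at both ends gives (s - l) * u y * i1 <= C * i2, the boundary terms
   having the favourable sign. *)
exists (C * i2 / ((s - l) * i1)) => f u v fs f0 sol u0 y yI.
have vN x z : p <= x -> x <= z -> z <= q -> v z <= v x.
  move=> px xz zq; have [_ dv] := ivp_solS px zq sol.
  apply: (ac_primitive_le xz dv); apply: aeW => t; rewrite in_itv /= => /andP[xt tz].
  by rewrite oppr_le0 mulr_ge0// a0//; lra.
have lowb x : p <= x <= q -> u y * dl x <= u x.
  by move=> xI'; exact: (concave_lower_bound pq sol.1 vN u0).
have [sol1 sol2] := ivp_solS pp1 q1q sol.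
have le1 := ltW p1q1.
have dW := ac_primitiveB le1 (ac_primitiveM le1 sol2 (C1_in_ac le1 C1'))
  (ac_primitiveM le1 (C1_in_ac le1 sol1) ac').
have dK := ac_primitiveB le1 (ac_primitiveZ ((s - l) * u y) le1 (primitive_ac p1 q1 ih1))
  (ac_primitiveZ C le1 (primitive_ac p1 q1 ih2)).
have := ac_primitive_le le1 (ac_primitiveD dW dK).
rewrite fp1 fq1 !mulr0 !sub0r => H.
have {}H : - (u q1 * phi' q1) + ((s - l) * u y * primitive h1 q1 - C * primitive h2 q1)
  <= - (u p1 * phi' p1) + ((s - l) * u y * primitive h1 p1 - C * primitive h2 p1).
  apply: H; apply: aeW => x; rewrite in_itv /= => xpq.
  have xI' : p <= x <= q by lra.
  have ax : 0 <= a x by apply: a0; lra.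
  have px := posI x xpq; have ux := u0 x xI'; have lx := lowb x xI'; have fx := fs _ ux.
  rewrite /h1 /h2 (cut x xpq) mulr1.
  have -> : v x * phi' x + phi x * - (a x * f (u x)) -
     (u x * - (l * a x * phi x) + phi' x * v x) +
     ((s - l) * u y * (a x * (phi x * dl x)) - C * (a x * phi x)) =
     - (a x * phi x * (f (u x) - l * u x - (s - l) * (u y * dl x) + C)) by ring.
  rewrite oppr_le0 mulr_ge0 ?mulr_ge0//; first exact: ltW.
  have : (s - l) * (u y * dl x) <= (s - l) * u x by rewrite ler_wpM2l//; lra.
  lra.
have e1 : u q1 * phi' q1 <= 0 by rewrite mulr_ge0_le0// u0//; lra.
have e2 : 0 <= u p1 * phi' p1 by rewrite mulr_ge0// u0//; lra.
rewrite ler_pdivlMr; last by rewrite mulr_gt0//; lra.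
rewrite /i1 /i2; lra.
Qed.

End NodalBound.

(** * Maximum principle off the positivity set of the weight *)

Section MaximumPrinciple.
Context {R : realType}.
Notation mu := (@lebesgue_measure R).
Implicit Types (p q : R) (u v : R -> R).

Context (T M : R) (a f u v : R -> R).
Context (sol : ivp_sol a f 0 T u v) (f0 : forall s, 0 <= f s).
Context (uM : forall x, 0 <= x <= T -> 0 < a x -> u x <= M).

(** Points with a > 0 have u <= M, so a <= 0 wherever u > M; as f >= 0, the derivative - a f (u) of
    v is nonnegative there. *)
Let v_mono s t : 0 <= s -> s <= t -> t <= T -> (forall x, s < x < t -> M < u x) ->
  v s <= v t.
Proof.
move=> s0 st tT H; have [_ dv] := ivp_solS s0 tT sol.
apply: (ac_primitive_ge st dv); apply: aeW => x; rewrite in_itv /= => xst.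
rewrite oppr_ge0 mulr_le0_ge0// leNgt; apply/negP => ax.
have xT : 0 <= x <= T by lra.
by have := uM xT ax; have := H x xst; lra.
Qed.

(** Leftwards the slope stays at or below v x < 0 as long as u > M. So u exceeds its value at x
    there and can never come down to M. *)
Let going_left x : 0 <= x <= T -> M < u x -> v x < 0 ->
  forall z, 0 <= z <= x -> M < u z /\ v z <= v x.
Proof.
move=> /andP[x0 xT] ux vx.
have [solx _] := ivp_solS (lexx 0) xT sol.
have C1 := C1_in_subcst M solx.
have pos z : 0 <= z <= x -> M < u z.
  move=> /andP[z0]; rewrite le_eqVlt => /predU1P[->//|zx].
  rewrite ltNge; apply/negP => uz.
  have [|||p [/andP[zp px] up pos]] := @last_crossing _ _ _ _ _ z C1; [lra|lra|lra|].
  have p0 : 0 <= p by lra.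
  have [w [pw wx E]] := C1_in_mvt solx p0 px (lexx x).
  have : v w <= v x by apply: v_mono; [lra|lra|lra|move=> y hy; have := pos y ltac:(lra); lra].
  have : 0 < x - p by lra.
  move=> h1 h2; have : v w * (x - p) < 0 by rewrite pmulr_llt0//; lra.
  lra.
move=> z zx; split; first exact: pos.
by apply: v_mono; [lra|lra|lra|move=> y hy; apply: pos; lra].
Qed.

Let going_right x : 0 <= x <= T -> M < u x -> 0 < v x ->
  forall z, x <= z <= T -> M < u z /\ v x <= v z.
Proof.
move=> /andP[x0 xT] ux vx.
have [solx _] := ivp_solS x0 (lexx T) sol.
have C1 := C1_in_subcst M solx.
have pos z : x <= z <= T -> M < u z.
  move=> /andP[+ zT]; rewrite le_eqVlt => /predU1P[<-//|xz].
  rewrite ltNge; apply/negP => uz.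
  have [|||p [/andP[xp pz] up pos]] := @first_crossing _ _ _ _ _ z C1; [left; lra|lra|lra|].
  have pT : p <= T by lra.
  have [w [xw wp E]] := C1_in_mvt solx (lexx x) xp pT.
  have : v x <= v w by apply: v_mono; [lra|lra|lra|move=> y hy; have := pos y ltac:(lra); lra].
  have h1 : 0 < p - x by lra.
  move=> h2; have : 0 < v w * (p - x) by rewrite mulr_gt0//; lra.
  lra.
move=> z xz; split; first exact: pos.
by apply: v_mono; [lra|lra|lra|move=> y hy; apply: pos; lra].
Qed.

(* Where u > M the function u is convex, so it would keep growing up to the
   boundary; the boundary conditions exclude this. *)
Lemma max_principle y : 0 <= y <= T -> u y <= M ->
  (v 0 = 0 /\ v T = 0) \/ (u T = u 0 /\ v T = v 0) ->
  forall x, 0 <= x <= T -> u x <= M.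
Proof.
move=> yT uy bc x xT; rewrite leNgt; apply/negP => ux.
have C1 := C1_in_subcst M sol.1.
have T0 : 0 <= T by lra.
have i0 : 0 <= (0 : R) <= T by rewrite lexx.
have iT : 0 <= T <= T by rewrite lexx T0.
have [xy|yx|E] := ltgtP x y; last by rewrite E in ux; lra.
  have C1x : C1_in `[x, T] (fun x => u x - M) v.
    by apply: C1_inS C1 => z /=; rewrite !in_itv /= => /andP[]; lra.
  have [z [wI uw vw]] : exists z, [/\ 0 <= z <= T, M < u z & v z < 0].
    have [|||p' [/andP[xp' p'p] up' pos]] := @first_crossing _ _ _ _ _ y C1x; [left; lra|lra|lra|].
    have [z [xz zp' E']] := C1_in_mvt sol.1 (proj1 (andP xT)) xp' ltac:(lra).
    exists z; split; [lra|have := pos z ltac:(lra); lra|].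
    rewrite ltNge; apply/negP => vz.
    have : 0 <= v z * (p' - x) by rewrite mulr_ge0//; lra.
    lra.
  have z0 : 0 <= (0 : R) <= z by lra.
  have [u0 v0] := going_left wI uw vw z0.
  case: bc => [[]|[uTE vTE]]; first lra.
  have [] := going_left iT ltac:(lra) ltac:(lra) yT; lra.
have C1x : C1_in `[0, x] (fun x => u x - M) v.
  by apply: C1_inS C1 => z /=; rewrite !in_itv /= => /andP[]; lra.
have [|||p [/andP[yp px] up pos]] := @last_crossing _ _ _ _ _ y C1x; [lra|lra|lra|].
have p0 : 0 <= p by lra.
have [z [pz zx E]] := C1_in_mvt sol.1 p0 px (proj2 (andP xT)).
have vz : 0 < v z.
  rewrite ltNge; apply/negP => vz.
  have : v z * (x - p) <= 0 by rewrite mulr_le0_ge0//; lra.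
  lra.
have uz : M < u z by have := pos z ltac:(lra); lra.
have zI : 0 <= z <= T by lra.
have zT : z <= T <= T by lra.
have [uT vT] := going_right zI uz vz zT.
case: bc => [[]|[uTE vTE]]; first lra.
by have [] := going_right i0 ltac:(lra) ltac:(lra) yT; lra.
Qed.

End MaximumPrinciple.

(** * Zeros of planar maps *)

Section SpernerGrid.
Local Open Scope nat_scope.
Context (N : nat) (A B : nat -> nat -> bool).

Definition ab_edge i j i' j' := (A i j && B i' j') || (B i j && A i' j').

(* Sperner's parity argument: without a rainbow triangle, the parity of the
   number of A-B edges is the same along every horizontal grid line. *)
Lemma sperner_grid :
  (forall i j, ~~ (A i j && B i j)) ->
  (forall j, (j <= N)%N -> ~~ B 0 j) ->
  (forall j, (j <= N)%N -> ~~ A N j) ->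
  (forall i, (i <= N)%N -> ~~ A i N) -> A 0 0 ->
  (forall i, (i < N)%N -> A i 0 || A i.+1 0 ->
     (A i 0 || B i 0) && (A i.+1 0 || B i.+1 0)) ->
  exists i1 j1 i2 j2 i3 j3 : nat,
    [/\ [/\ (i1 <= i3.+1)%N, (i3 <= i1.+1)%N, (j1 <= j3.+1)%N & (j3 <= j1.+1)%N],
        [/\ (i2 <= i3.+1)%N, (i3 <= i2.+1)%N, (j2 <= j3.+1)%N & (j3 <= j2.+1)%N],
        [/\ (i1 <= N)%N, (j1 <= N)%N, (i2 <= N)%N & (j2 <= N)%N],
        (i3 <= N)%N && (j3 <= N)%N &
        [/\ A i1 j1, B i2 j2 & ~~ A i3 j3 && ~~ B i3 j3]].
Proof.
move=> AB left right top A00 bottom; apply: contrapT => noT.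
pose cell i j i' j' := [&& i <= i', i' <= i.+1, j <= j' & j' <= j.+1].
have rainbow i j i1 j1 i2 j2 i3 j3 : i < N -> j < N -> cell i j i1 j1 ->
    cell i j i2 j2 -> cell i j i3 j3 ->
    ~~ [&& A i1 j1, B i2 j2, ~~ A i3 j3 & ~~ B i3 j3].
  move=> iN jN /and4P[? ? ? ?] /and4P[? ? ? ?] /and4P[? ? ? ?].
  apply/negP => /and4P[a b c1 c2]; apply: noT.
  exists i1, j1, i2, j2, i3, j3; split; [by split; lia..|by apply/andP; split; lia|].
  by split => //; rewrite c1 c2.
(* A triangle that is not rainbow has an even number of A-B edges. The vertices are only asked to
   lie in a common cell, which covers both halves of it. *)
have parity i j i1 j1 i2 j2 i3 j3 : i < N -> j < N -> cell i j i1 j1 ->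
    cell i j i2 j2 -> cell i j i3 j3 ->
    ab_edge i1 j1 i2 j2 (+) ab_edge i2 j2 i3 j3 = ab_edge i1 j1 i3 j3.
  move=> iN jN c1 c2 c3; have Rb := rainbow _ _ _ _ _ _ _ _ iN jN.
  move: (AB i1 j1) (AB i2 j2) (AB i3 j3) (Rb _ _ _ _ _ _ c1 c2 c3)
    (Rb _ _ _ _ _ _ c2 c1 c3) (Rb _ _ _ _ _ _ c1 c3 c2) (Rb _ _ _ _ _ _ c3 c1 c2)
    (Rb _ _ _ _ _ _ c2 c3 c1) (Rb _ _ _ _ _ _ c3 c2 c1); rewrite /ab_edge.
  by case: (A i1 j1) => /=; case: (A i2 j2) => /=; case: (A i3 j3) => /=;
     case: (B i1 j1) => //=; case: (B i2 j2) => //=; case: (B i3 j3).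
pose row j n := \big[addb/false]_(i < n) ab_edge i j i.+1 j.
(* Both triangles of each cell in a strip are added up: the diagonals cancel and only the outer
   vertical edges remain. *)
have rowS j n : (n <= N)%N -> (j < N)%N ->
    row j n (+) ab_edge n j n j.+1 = ab_edge 0 j 0 j.+1 (+) row j.+1 n.
  move=> + jN; elim: n => [_|n IH nN]; first by rewrite /row !big_ord0 addFb addbF.
  rewrite /row !big_ord_recr /= -!/(row _ n).
  have p1 : ab_edge n j n.+1 j (+) ab_edge n.+1 j n.+1 j.+1 = ab_edge n j n.+1 j.+1.
    by apply: (parity n j) => //; rewrite /cell ?leqnn ?leqnSn.
  have p2 : ab_edge n j n j.+1 (+) ab_edge n j.+1 n.+1 j.+1 = ab_edge n j n.+1 j.+1.
    by apply: (parity n j) => //; rewrite /cell ?leqnn ?leqnSn.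
  by rewrite -addbA p1 -p2 !addbA IH// ltnW.
have rowE j : (j <= N)%N -> row j N = row 0%N N.
  elim: j => [//|j IH] jN; rewrite -IH; last exact: ltnW.
  have := rowS j N (leqnn N) jN; rewrite /ab_edge.
  rewrite (negbTE (left _ jN)) (negbTE (left _ (ltnW jN))).
  rewrite (negbTE (right _ jN)) (negbTE (right _ (ltnW jN))).
  by rewrite !andbF /= addbF => ->.
have rowN : row N N = false.
  rewrite /row big1// => i _; rewrite /ab_edge.
  by rewrite (negbTE (top _ (ltnW (ltn_ord i)))) (negbTE (top _ (ltn_ord i))) andbF.
(* On the bottom line every neighbour of an A vertex is A or B, so the A-B edges are exactly the
   changes between A and not A. Going from A at (0, 0) to not A at (N, 0) makes their number odd,
   against an empty top row. *)
have row0 n : (n <= N)%N -> row 0%N n = A 0 0 (+) A n 0.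
  elim: n => [_|n IH nN]; first by rewrite /row big_ord0 addbb.
  rewrite /row big_ord_recr /= -/(row 0%N n) IH; last exact: ltnW.
  have := bottom n nN; have := AB n 0%N; have := AB n.+1 0%N; rewrite /ab_edge -addbA.
  by case: (A n 0); case: (A n.+1 0); case: (B n 0); case: (B n.+1 0) => //= _ _ /(_ isT).
have := row0 N (leqnn N); rewrite -(rowE N)// rowN A00 (negbTE (right 0%N _))//.
Qed.

End SpernerGrid.

Section PlanarZero.
Context {R : realType}.

Definition lip_square (F : R -> R -> R) (K : R) := forall x y x' y',
  0 <= x <= 1 -> 0 <= y <= 1 -> 0 <= x' <= 1 -> 0 <= y' <= 1 ->
  `|F x y - F x' y'| <= K * (`|x - x'| + `|y - y'|).

(** Compactness turns approximate zeros, all that a finite grid can give, into an exact one. *)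
Lemma lip_square_attains (F : R -> R -> R) (K : R) : 0 <= K -> lip_square F K ->
  (forall x y, 0 <= F x y) ->
  (forall e, 0 < e -> exists x y, [/\ 0 <= x <= 1, 0 <= y <= 1 & F x y <= e]) ->
  exists x y, [/\ 0 <= x <= 1, 0 <= y <= 1 & F x y = 0].
Proof.
move=> K0 lF F0 inf0.
pose H (p : R * R) := F (clamp 0 1 p.1) (clamp 0 1 p.2).
have c01 x : 0 <= clamp 0 1 x <= (1 : R) by exact: clamp_itv.
have cH : continuous H.
  move=> p; apply/cvgrPdist_le => e e0.
  have D : 0 < 2 * K + 1 by lra.
  have r0 : 0 < e / (2 * K + 1) by rewrite divr_gt0.
  exists (ball p.1 (e / (2 * K + 1)), ball p.2 (e / (2 * K + 1))).
    by split; exact: nbhsx_ballx.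
  move=> [x y] [/=]; rewrite /ball /= !ltr_pdivlMr// => h1 h2.
  apply: (le_trans (lF _ _ _ _ (c01 _) (c01 _) (c01 _) (c01 _))).
  have := clamp_lip 0 1 p.1 x; have := clamp_lip 0 1 p.2 y.
  have := normr_ge0 (p.1 - x); have := normr_ge0 (p.2 - y); nra.
have cS : compact (`[0 : R, 1]%classic `*` `[0 : R, 1]%classic).
  by apply: compact_setX; exact: segment_compact.
have [] := @compact_EVT_min _ _ H _ _ cS.
- by exists (0, 0); split; rewrite /= in_itv /= lexx ler01.
- exact: continuous_subspaceT.
move=> [x y]; rewrite inE /= !in_itv /= => -[x01 y01] min.
exists x, y; split => //; apply/eqP; rewrite eq_le F0 andbT.
apply/ler_addgt0Pr => e e0; rewrite add0r.
have [x' [y' [x1 y1 Fe]]] := inf0 e e0.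
have := min (x', y'); rewrite inE /= !in_itv /= x1 y1 /H /= !clampE// => /(_ (conj isT isT)).
by move/le_trans; apply.
Qed.

(** Grid points are labelled A if F > 0, B if F <= 0 < G, and otherwise left unlabelled. In a
    rainbow triangle of small mesh the unlabelled vertex has F and G nonpositive yet close to
    positive values, so both are small. *)
Lemma planar_zero (F G : R -> R -> R) (K : R) : 0 < K ->
  lip_square F K -> lip_square G K ->
  (forall y, 0 <= y <= 1 -> F 0 y <= 0 -> G 0 y < 0) ->
  (forall x, 0 <= x <= 1 -> F x 0 = 0 -> 0 < G x 0) ->
  0 < F 0 0 -> (forall y, 0 <= y <= 1 -> F 1 y <= 0) ->
  (forall x, 0 <= x <= 1 -> F x 1 <= 0) ->
  exists x y, [/\ 0 <= x <= 1, 0 <= y <= 1, F x y = 0 & G x y = 0].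
Proof.
move=> K0 lF lG left bottom F00 right top.
have i0 : 0 <= (0 : R) <= 1 by rewrite lexx ler01.
have i1 : 0 <= (1 : R) <= 1 by rewrite lexx ler01.
(* By compactness the bottom condition gets a margin: G > 0 already when F lies in [-m, 0]. A grid
   step from F > 0 to F <= 0 lands in that band, so the new vertex is labelled B. *)
have [m m0 Hm] : exists2 m, 0 < m & forall x, 0 <= x <= 1 -> - m <= F x 0 -> F x 0 <= 0 -> 0 < G x 0.
  apply: contrapT => nm.
  pose h (x y : R) := `|F x 0| + Num.max 0 (G x 0).
  have [x [y [x01 _ /eqP]]] : exists x y, [/\ 0 <= x <= 1, 0 <= y <= 1 & h x y = 0].
    apply: (@lip_square_attains h (2 * K)); first by rewrite mulr_ge0// ltW.
    - move=> x y x' y' hx hy hx' hy'; rewrite /h.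
      have h1 := lF _ _ _ _ hx i0 hx' i0; have h2 := lG _ _ _ _ hx i0 hx' i0.
      rewrite subrr normr0 addr0 in h1 h2.
      have h3 := ler_dist_dist (F x 0) (F x' 0).
      have h4 := le_trans (max_lip 0 (G x 0) (G x' 0)) h2.
      have h5 : 0 <= K * `|y - y'| by rewrite mulr_ge0// ltW.
      have h6 : 0 <= K * `|x - x'| by rewrite mulr_ge0// ltW.
      rewrite opprD addrACA (le_trans (ler_normD _ _))//; lra.
    - by move=> x y; rewrite addr_ge0// le_max lexx.
    move=> e e0; apply: contrapT => ne; apply: nm; exists e => // x x01 xe Fx.
    rewrite ltNge; apply/negP => Gx; apply: ne; exists x, 0; split => //.
    by rewrite /h (max_idPl Gx) addr0 ler0_norm//; lra.
  rewrite paddr_eq0 ?le_max ?lexx// normr_eq0 => /andP[/eqP Fx /eqP Gx].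
  have := bottom x x01 Fx; have : G x 0 <= Num.max 0 (G x 0) by rewrite le_max lexx orbT.
  by rewrite Gx; lra.
pose h (x y : R) := `|F x y| + `|G x y|.
suff [x [y [x01 y01 /eqP]]] : exists x y, [/\ 0 <= x <= 1, 0 <= y <= 1 & h x y = 0].
  by rewrite paddr_eq0// !normr_eq0 => /andP[/eqP ? /eqP ?]; exists x, y.
apply: (@lip_square_attains h (2 * K)); first by rewrite mulr_ge0// ltW.
- move=> x y x' y' hx hy hx' hy'; rewrite /h.
  have h1 := lF _ _ _ _ hx hy hx' hy'; have h2 := lG _ _ _ _ hx hy hx' hy'.
  have h3 := ler_dist_dist (F x y) (F x' y'); have h4 := ler_dist_dist (G x y) (G x' y').
  rewrite opprD addrACA (le_trans (ler_normD _ _))//; lra.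
- by move=> x y; rewrite addr_ge0.
move=> e e0.
(* F and G vary by at most M within a cell: M <= m serves the bottom side, and M <= e / 4 makes |F|
   + |G| <= e. The grid size N is chosen so that 2 K / N <= M. *)
pose M := Num.min m (e / 4).
have M0 : 0 < M by rewrite lt_min m0 divr_gt0.
pose N := Num.bound (2 * K / M).
have KN : 2 * K / M < N%:R by apply: archi_boundP; rewrite divr_ge0 ?mulr_ge0// ltW.
have N0 : 0 < N%:R :> R by apply: le_lt_trans KN; rewrite divr_ge0 ?mulr_ge0// ltW.
have KNM : 2 * K / N%:R <= M by rewrite ler_pdivrMr// [leRHS]mulrC -ler_pdivrMr// ltW.
pose g (i : nat) : R := i%:R / N%:R.
have g01 i : (i <= N)%N -> 0 <= g i <= 1.
  move=> iN; rewrite divr_ge0 ?ler0n ?(ltW N0)//=.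
  by rewrite ler_pdivrMr// mul1r ler_nat.
have gN : g N = 1 by rewrite /g divff// gt_eqF.
have g0 : g 0%N = 0 by rewrite /g mul0r.
have gd i j : (i <= j.+1)%N -> (j <= i.+1)%N -> `|g i - g j| <= 1 / N%:R.
  move=> ij ji; rewrite /g -mulrBl normrM (gtr0_norm (_ : 0 < N%:R^-1)) ?invr_gt0//.
  rewrite ler_pM2r ?invr_gt0// ler_norml.
  move: ij ji; rewrite -!(ler_nat R) -!natr1; lra.
pose A i j := 0 < F (g i) (g j).
pose B i j := ~~ A i j && (0 < G (g i) (g j)).
have [||||||i1' [j1 [i2 [j2 [i3 [j3]]]]]] := @sperner_grid N A B.
- by move=> i j; rewrite /B andbA andbN.
- move=> j jN; rewrite /B /A g0 -leNgt; apply/negP => /andP[Fj Gj].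
  by have := left _ (g01 j jN) Fj; lra.
- by move=> j jN; rewrite /A gN -leNgt right// g01.
- by move=> j jN; rewrite /A gN -leNgt top// g01.
- by rewrite /A g0.
- have key i j : (i <= N)%N -> (j <= N)%N -> (i <= j.+1)%N -> (j <= i.+1)%N -> A i 0%N -> A j 0%N || B j 0%N.
    move=> iN jN ij ji; rewrite /B /A g0 => Ai.
    have [//|/= Aj] := boolP (0 < F (g j) 0).
    rewrite -leNgt in Aj; apply: Hm => //; first exact: g01.
    have := lF _ _ _ _ (g01 _ iN) i0 (g01 _ jN) i0.
    rewrite subrr normr0 addr0 ler_norml => /andP[_ h1].
    have h2 : K * `|g i - g j| <= K * (1 / N%:R) by rewrite ler_pM2l// gd.
    have : M <= m by rewrite ge_min lexx.
    have : 0 < K * (1 / N%:R) by rewrite mulr_gt0// divr_gt0.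
    lra.
  move=> i iN /orP[Ai|Ai]; rewrite Ai /= ?andbT; apply: key Ai => //; exact: ltnW.
move=> [[p1 p2 p3 p4] [q1 q2 q3 q4] [r1 r2 r3 r4] /andP[s1 s2] [A1 B2 /andP[A3 B3]]].
exists (g i3), (g j3); split; rewrite ?g01//.
move: B3; rewrite /B A3 /=; move: A3; rewrite /A -!leNgt => F3 G3.
have G2 : 0 < G (g i2) (g j2) by case/andP: B2.
have e1 := lF _ _ _ _ (g01 _ r1) (g01 _ r2) (g01 _ s1) (g01 _ s2).
have e2 := lG _ _ _ _ (g01 _ r3) (g01 _ r4) (g01 _ s1) (g01 _ s2).
have d1 : K * (`|g i1' - g i3| + `|g j1 - g j3|) <= M.
  apply: le_trans KNM; have := gd _ _ p1 p2; have := gd _ _ p3 p4.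
  have -> : 2 * K / N%:R = K * (1 / N%:R + 1 / N%:R) by ring.
  by move=> ? ?; rewrite ler_pM2l// lerD.
have d2 : K * (`|g i2 - g i3| + `|g j2 - g j3|) <= M.
  apply: le_trans KNM; have := gd _ _ q1 q2; have := gd _ _ q3 q4.
  have -> : 2 * K / N%:R = K * (1 / N%:R + 1 / N%:R) by ring.
  by move=> ? ?; rewrite ler_pM2l// lerD.
have Me : M <= e / 4 by rewrite ge_min lexx orbT.
move: e1 e2 A1; rewrite /A !ler_norml => /andP[_ e1] /andP[_ e2] A1.
rewrite /h !ler0_norm//; lra.
Qed.

End PlanarZero.

(** * Shooting *)

Section Existence.
Context {R : realType} (T L al be Rb : R) (a f : R -> R).
Context (T0 : 0 < T) (L0 : 0 < L) (ia : lebesgue_integrable a).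
Context (a0 : forall x, ~~ (0 <= x <= T) -> a x = 0).
Context (a_neg : primitive a T - primitive a 0 < 0).
Context (lf : lipschitzian f L) (fN : forall s, s <= 0 -> f s = 0)
  (f_gt0 : forall s, 0 < s -> 0 < f s)
  (f_small : forall e, 0 < e -> exists2 r, 0 < r &
    forall s t, 0 <= s <= r -> 0 <= t <= r -> `|f s - f t| <= e * `|s - t|).
Context (al0 : 0 <= al) (albe : al < be) (beT : be <= T)
  (bounded : forall u v, ivp_sol a f 0 T u v -> (forall x, 0 <= x <= T -> 0 <= u x) ->
     forall x, al <= x <= be -> u x <= Rb).
Notation m := (total_mass T a).
Notation K := (growth_const T L a).
Implicit Types (u v : R -> R).

Let f_ge0 s : 0 <= f s.
Proof. by have [/fN ->|/f_gt0/ltW] := leP s 0. Qed.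

Let i0 : 0 <= (0 : R) <= T. Proof. by rewrite lexx ltW. Qed.
Let iT : 0 <= T <= T. Proof. by rewrite lexx ltW. Qed.
Let K1 : 1 <= K. Proof. exact: growth_const_ge1. Qed.
Let K_gt0 : 0 < K. Proof. exact: lt_le_trans ltr01 K1. Qed.
Let m0 : 0 <= m. Proof. exact: total_mass_ge0. Qed.

(** On [al, be] u lies in [0, |Rb|], so the mean value theorem finds a point z where the slope is at
    most |Rb| / (be - al) in size. Gronwall carries the bounds at z back to 0. *)
Lemma initial_data_bound : exists2 C, 0 <= C & forall u v, ivp_sol a f 0 T u v ->
  (forall x, 0 <= x <= T -> 0 <= u x) -> `|u 0| + `|v 0| <= C.
Proof.
have [al0' beT' albe'] := And3 al0 beT albe.
pose D := be - al; have D0 : 0 < D by rewrite subr_gt0.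
pose B := `|Rb| + `|Rb| / D.
have B0 : 0 <= B by rewrite addr_ge0// divr_ge0// ltW.
exists (2 * K * B); first by rewrite !mulr_ge0// ltW.
move=> u v sol u0.
have [z [az zb E]] := C1_in_mvt sol.1 al0 albe beT.
have bu x : al <= x <= be -> 0 <= u x <= `|Rb|.
  move=> xI; have xT : 0 <= x <= T by lra.
  rewrite u0//=; exact: le_trans (bounded sol u0 xI) (ler_norm _).
have uz : `|u z| <= `|Rb|.
  have /andP[h1 h2] : 0 <= u z <= `|Rb| by apply: bu; lra.
  by rewrite ger0_norm.
have vz : `|v z| <= `|Rb| / D.
  rewrite ler_pdivlMr// -[X in _ * X](gtr0_norm D0) -normrM -E ler_norml.
  by have := bu al ltac:(lra); have := bu be ltac:(lra); lra.
have zI : 0 <= z <= T by lra.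
have [h1 h2] := ivp_small T0 L0 ia lf fN sol zI i0.
have h3 : K * (`|u z| + `|v z|) <= K * B by rewrite ler_pM2l// lerD.
lra.
Qed.

Lemma small_data : exists2 e, 0 < e & exists2 r, 0 < r &
  [/\ forall s t, 0 <= s <= r -> 0 <= t <= r -> `|f s - f t| <= e * `|s - t|,
      forall s, `|s| <= r -> `|f s| <= e * `|s|,
      4 * T * e * m <= 1 & e * T * m ^+ 2 < - (primitive a T - primitive a 0)].
Proof.
have T0' := T0.
have [J JE] : exists J, J = - (primitive a T - primitive a 0) by eexists.
have J0 : 0 < J by rewrite JE oppr_gt0.
(* e = 1 / Q must satisfy two smallness conditions, so Q dominates 4 T m and strictly dominates T m
   ^ 2 / J. *)
pose Q := 4 * T * m + 2 * (T * m ^+ 2 / J) + 1.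
have p1 : 0 <= 4 * T * m by rewrite !mulr_ge0// ltW.
have p2 : 0 <= T * m ^+ 2 / J by rewrite divr_ge0 ?(ltW J0)// mulr_ge0 ?sqr_ge0// ltW.
have Q0 : 0 < Q by rewrite /Q; lra.
have e0 : 0 < Q^-1 by rewrite invr_gt0.
exists Q^-1 => //; have [r r0 Hr] := f_small e0.
exists r => //; split => //.
- move=> s; have [s0 _|s0] := leP s 0; first by rewrite fN// normr0 mulr_ge0// ltW.
  rewrite gtr0_norm// => sr; have := Hr s 0.
  by rewrite (fN (lexx 0)) !subr0 (gtr0_norm s0); apply; lra.
- have -> : 4 * T * Q^-1 * m = 4 * T * m / Q by ring.
  by rewrite ler_pdivrMr// /Q; lra.
have -> : Q^-1 * T * m ^+ 2 = J * (T * m ^+ 2 / J) / Q by field; rewrite !gt_eqF.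
by rewrite ltr_pdivrMr// -JE ltr_pM2l// /Q; lra.
Qed.

Let pos_of_final u v : ivp_sol a f 0 T u v -> 0 < u 0 -> 0 < u T ->
  forall x, 0 <= x <= T -> 0 < u x.
Proof.
move=> sol c0 uT x /andP[]; rewrite le_eqVlt => /predU1P[<-//|x0] xT.
apply: (ivp_u_pos T0 L0 ia lf fN sol) => //; [exact: ltW|by left|].
by rewrite x0.
Qed.

Lemma flow_exists : exists U V : R -> R -> R -> R, forall c d,
  [/\ ivp_sol a f 0 T (U c d) (V c d), U c d 0 = c & V c d 0 = d].
Proof.
have H cd : {uv : (R -> R) * (R -> R) |
    [/\ ivp_sol a f 0 T uv.1 uv.2, uv.1 0 = cd.1 & uv.2 0 = cd.2]}.
  apply: cid; have [u [v uv]] := @ivp_exists R T L cd.1 cd.2 a f T0 L0 ia a0 lf.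
  by exists (u, v).
exists (fun c d => (sval (H (c, d))).1), (fun c d => (sval (H (c, d))).2) => c d.
by case: (H (c, d)).
Qed.

Lemma neumann_exists : exists u v, [/\ ivp_sol a f 0 T u v, v 0 = 0, v T = 0 &
  forall x, 0 <= x <= T -> 0 < u x].
Proof.
have [U [V UV]] := flow_exists.
have [e e0 [r r0 [Hr1 Hr2 em eJ]]] := small_data.
have [C C0 HC] := initial_data_bound.
have [K0 T0' L0' m0'] := And4 K_gt0 T0 L0 m0.
(* With this size the Gronwall factor K keeps the whole solution inside [-r, r], where f is nearly
   flat. *)
pose c0 := r / K; have c00 : 0 < c0 by rewrite divr_gt0.
have [sol U0 V0] := UV c0 0.
have ur x : 0 <= x <= T -> `|U c0 0 x| <= r.
  move=> xT; have [h _] := ivp_small T0 L0 ia lf fN sol i0 xT.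
  move: h; rewrite U0 V0 normr0 addr0 (gtr0_norm c00) /c0 mulrCA divff ?mulr1//.
  by rewrite gt_eqF.
have ub x : 0 <= x <= T -> 0 < U c0 0 x <= r.
  move=> xT; have := ivp_small_f T0 ia (ltW e0) sol Hr2 em ur.
  rewrite U0 V0 => /(_ (ltW c00) (lexx 0) x xT); have := ur x xT.
  by rewrite !mul0r addr0 !ler_norml; lra.
have VT0 : 0 < V c0 0 T.
  rewrite -[ltLHS]V0.
  exact: (ivp_v_increases T0 L0 ia lf (ltW e0) sol f_gt0 f_ge0 Hr1 eJ ub i0 V0).
(* A zero would force v T < 0 by [ivp_crossing]. This serves twice: to contradict
   [initial_data_bound] at c1, and for the positivity of the solution found. *)
have neg c u v : 0 < c -> ivp_sol a f 0 T u v -> u 0 = c -> v 0 = 0 -> 0 <= v T ->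
    forall x, 0 <= x <= T -> 0 < u x.
  move=> cpos solc uc vc vT x /andP[]; rewrite le_eqVlt => /predU1P[<-|x0] xT.
    by rewrite uc.
  rewrite ltNge; apply/negP => ux.
  have xI : 0 < x <= T by rewrite x0.
  have [||_] := ivp_crossing T0 L0 ia lf fN solc _ _ xI ux.
  - by rewrite uc ltW.
  - by left; rewrite uc.
  by rewrite ltNge vT.
pose c1 := c0 + C + 1.
have c10 : 0 < c1 by rewrite /c1; lra.
have V1 : V c1 0 T < 0.
  have [sol1 U1 V1] := UV c1 0.
  rewrite ltNge; apply/negP => vT.
  have := HC _ _ sol1 (fun x xT => ltW (neg _ _ _ c10 sol1 U1 V1 vT x xT)).
  by rewrite U1 V1 normr0 addr0 gtr0_norm// /c1; lra.
have cV : continuous (fun c => V c 0 T).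
  apply: (@lipschitzian_continuous _ _ K) => [|s t]; first exact: ltW.
  have [s1 U1 V1'] := UV s 0; have [s2 U2 V2] := UV t 0.
  have [_] := ivp_lip T0 L0 ia lf s1 s2 i0 iT.
  by rewrite U1 U2 V1' V2 subrr normr0 addr0.
have [|||c] := @IVT R (fun c => V c 0 T) c0 c1 0.
- by rewrite /c1; lra.
- exact: continuous_subspaceT.
- by rewrite ge_min le_max (ltW V1) (ltW VT0) orbT.
rewrite in_itv /= => /andP[cc _] Vc.
have [solc Uc Vc0] := UV c 0.
have cpos : 0 < c by lra.
have vT : 0 <= V c 0 T by rewrite Vc.
exists (U c 0), (V c 0); split => //.
exact: (neg c _ _ cpos solc Uc Vc0 vT).
Qed.

(* Initial data (c, d) = rho (x, 1 - (1 + M) x): the side x = 0 is u(0) = 0 and the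
   side x = 1 is u'(0) = - M u(0), so steep that u(T) < u(0). *)
Lemma periodic_exists : exists u v, [/\ ivp_sol a f 0 T u v, u T = u 0, v T = v 0 &
  forall x, 0 <= x <= T -> 0 < u x].
Proof.
have [U [V UV]] := flow_exists.
have [e e0 [r r0 [Hr1 Hr2 em eJ]]] := small_data.
have [C C0 HC] := initial_data_bound.
have [K0 T0' L0' m0'] := And4 K_gt0 T0 L0 m0.
pose M := L * m + 1.
have M1 : 1 <= M by rewrite /M lerDr mulr_ge0// ltW.
(* On the inner side |c| + |d| <= rho0 (1 + (1 + M)), so the solution stays within r after the
   Gronwall factor K. *)
pose rho0 := r / (K * (2 + M)).
have rho00 : 0 < rho0 by rewrite divr_gt0// mulr_gt0//; lra.
(* Since rho = d + (1 + M) c, one has rho <= (1 + M) (|c| + |d|); at rho1 the data therefore exceed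
   the bound C. *)
pose rho1 := (1 + M) * (C + 1) + rho0.
have rho01 : rho0 < rho1 by rewrite ltrDr mulr_gt0//; lra.
pose rho y := rho0 + (rho1 - rho0) * y.
pose c x y := rho y * x.
pose d x y := rho y * (1 - (1 + M) * x).
pose F x y := U (c x y) (d x y) T - c x y.
pose G x y := V (c x y) (d x y) T - d x y.
have rhoI y : 0 <= y <= 1 -> rho0 <= rho y <= rho1.
  move=> /andP[y0 y1]; rewrite /rho lerDl mulr_ge0//=; last by lra.
  have : (rho1 - rho0) * y <= (rho1 - rho0) * 1 by rewrite ler_wpM2l//; lra.
  lra.
have c_ge0 x y : 0 <= x <= 1 -> 0 <= y <= 1 -> 0 <= c x y.
  by move=> /andP[x0 _] /rhoI/andP[h _]; rewrite mulr_ge0//; lra.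
have c_gt0 x y : 0 < x <= 1 -> 0 <= y <= 1 -> 0 < c x y.
  by move=> /andP[x0 _] /rhoI/andP[h _]; rewrite mulr_gt0//; lra.
have cd x y : 0 <= x <= 1 -> 0 <= y <= 1 -> 0 < c x y \/ 0 < d x y.
  move=> /andP[]; rewrite le_eqVlt => /predU1P[<-|x0] x1 yI.
    by right; rewrite /d mulr0 subr0 mulr1; have := rhoI y yI; lra.
  by left; apply: c_gt0 => //; rewrite x0.
have one x : x = 0 \/ x = 1 -> 0 <= x <= (1 : R) by case=> ->; rewrite ?lexx ?ler01.
have zI := one 0 (or_introl erefl); have oI := one 1 (or_intror erefl).
have rhoE : rho 0 = rho0 by rewrite /rho mulr0 addr0.
have small x xx : 0 <= x <= 1 -> 0 <= xx <= T -> `|U (c x 0) (d x 0) xx| <= r.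
  move=> /andP[x0 x1] xT; have [sol U0 V0] := UV (c x 0) (d x 0).
  have [h _] := ivp_small T0 L0 ia lf fN sol i0 xT; apply: (le_trans h).
  rewrite U0 V0.
  have -> : r = K * (rho0 * (2 + M)) by rewrite /rho0; field; rewrite !gt_eqF//; lra.
  rewrite ler_pM2l// /c /d rhoE (normrM rho0 x) (normrM rho0 (1 - (1 + M) * x)).
  rewrite (gtr0_norm rho00) -mulrDr ler_pM2l//.
  rewrite (ger0_norm x0).
  have : `|1 - (1 + M) * x| <= 1 + M * 1.
    have h1 : M * x <= M * 1 by rewrite ler_wpM2l//; lra.
    have h2 : 0 <= M * x by rewrite mulr_ge0//; lra.
    by rewrite ler_norml; lra.
  lra.
(* Here u 0 = 0 and u is nearly affine, so u T is at least two thirds of d T. *)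
have corner : 0 < U (c 0 0) (d 0 0) T.
  have [sol U0 V0] := UV (c 0 0) (d 0 0); have sm := small 0 ^~ zI.
  move: sol U0 V0 sm; move: (U (c 0 0) (d 0 0)) (V (c 0 0) (d 0 0)) => u v sol U0 V0 sm.
  have c0 : c 0 0 = 0 by rewrite /c mulr0.
  have d0 : 0 < d 0 0 by rewrite /d /rho !mulr0 subr0 mulr1 addr0.
  have := ivp_small_f T0 ia (ltW e0) sol Hr2 em sm.
  rewrite U0 V0 c0 => /(_ (lexx 0) (ltW d0) T iT).
  rewrite !add0r ler_norml => /andP[h _].
  have : 0 < d 0 0 * T by rewrite mulr_gt0.
  lra.
have lipc x y x' y' : 0 <= x <= 1 -> 0 <= y <= 1 -> 0 <= x' <= 1 -> 0 <= y' <= 1 ->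
    `|c x y - c x' y'| + `|d x y - d x' y'| <= rho1 * (3 + M) * (`|x - x'| + `|y - y'|).
  move=> /andP[x0 x1] yI /andP[x0' x1'] yI'.
  have rr : `|rho y - rho y'| <= rho1 * `|y - y'|.
    have -> : rho y - rho y' = (rho1 - rho0) * (y - y') by rewrite /rho; ring.
    rewrite normrM ler_wpM2r// ger0_norm; lra.
  have hc : `|c x y - c x' y'| <= rho1 * (`|x - x'| + `|y - y'|).
    have -> : c x y - c x' y' = rho y * (x - x') + (rho y - rho y') * x'.
      by rewrite /c; ring.
    rewrite (le_trans (ler_normD _ _))// !normrM mulrDr lerD//.
      by rewrite ler_wpM2r//; have := rhoI y yI; rewrite ler_norml; lra.
    apply: (@le_trans _ _ (`|rho y - rho y'| * 1)); last by rewrite mulr1.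
    by rewrite ler_wpM2l// ger0_norm.
  have hd : `|d x y - d x' y'| <= `|rho y - rho y'| + (1 + M) * `|c x y - c x' y'|.
    have -> : d x y - d x' y' = (rho y - rho y') - (1 + M) * (c x y - c x' y').
      by rewrite /d /c; ring.
    by rewrite (le_trans (ler_normB _ _))// normrM (ger0_norm (_ : 0 <= 1 + M))//; lra.
  have h1 : (2 + M) * `|c x y - c x' y'| <= (2 + M) * (rho1 * (`|x - x'| + `|y - y'|)).
    by rewrite ler_wpM2l//; lra.
  have h2 : 0 <= rho1 * `|x - x'| by rewrite mulr_ge0//; lra.
  lra.
have lipUV x y x' y' : 0 <= x <= 1 -> 0 <= y <= 1 -> 0 <= x' <= 1 -> 0 <= y' <= 1 ->
    `|F x y - F x' y'| <= (K + 1) * (rho1 * (3 + M)) * (`|x - x'| + `|y - y'|) /\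
    `|G x y - G x' y'| <= (K + 1) * (rho1 * (3 + M)) * (`|x - x'| + `|y - y'|).
  move=> hx hy hx' hy'; have l := lipc _ _ _ _ hx hy hx' hy'.
  have [s1 U1 V1] := UV (c x y) (d x y); have [s2 U2 V2] := UV (c x' y') (d x' y').
  have [h1 h2] := ivp_lip T0 L0 ia lf s1 s2 i0 iT.
  rewrite U1 U2 V1 V2 in h1 h2.
  have h3 := ler_wpM2l (ltW K0) l.
  rewrite -[(K + 1) * _ * _]mulrA mulrDl mul1r; split.
    have -> : F x y - F x' y' = U (c x y) (d x y) T - U (c x' y') (d x' y') T -
      (c x y - c x' y') by rewrite /F; ring.
    apply: (le_trans (ler_normB _ _)); apply: lerD (le_trans h1 h3) (le_trans _ l).
    by rewrite lerDl.
  have -> : G x y - G x' y' = V (c x y) (d x y) T - V (c x' y') (d x' y') T -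
    (d x y - d x' y') by rewrite /G; ring.
  apply: (le_trans (ler_normB _ _)); apply: lerD (le_trans h2 h3) (le_trans _ l).
  by rewrite lerDr.
have left y : 0 <= y <= 1 -> F 0 y <= 0 -> G 0 y < 0.
  move=> yI; have [sol U0 V0] := UV (c 0 y) (d 0 y).
  have cE : c 0 y = 0 by rewrite /c mulr0.
  have dpos : 0 < d 0 y by case: (cd 0 y zI yI) => //; rewrite cE ltxx.
  rewrite /F /G [X in _ - X <= _]cE subr0 => uT.
  have [|||_ vT] := ivp_crossing T0 L0 ia lf fN sol _ _ _ uT.
  - by rewrite U0 cE.
  - by right; rewrite V0.
  - by rewrite T0 lexx.
  lra.
have KL : 0 < (K + 1) * (rho1 * (3 + M)).
  apply: mulr_gt0; first exact: addr_gt0.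
  by apply: mulr_gt0; [exact: lt_trans rho01|rewrite addr_gt0// (lt_le_trans _ M1)].
have [|||||||x [y [xI yI Fxy Gxy]]] := @planar_zero R F G _ KL.
- by move=> x y x' y' hx hy hx' hy'; have [] := lipUV _ _ _ _ hx hy hx' hy'.
- by move=> x y x' y' hx hy hx' hy'; have [] := lipUV _ _ _ _ hx hy hx' hy'.
- exact: left.
(* Inner side: if u T = u 0, the mean value theorem gives a point where v vanishes, so
   [ivp_v_increases] applies. The value x = 0 is excluded by the corner. *)
- move=> x /andP[]; rewrite le_eqVlt => /predU1P[<-|x0] x1 Fx.
    by move: Fx corner; rewrite /F /c mulr0 subr0 => ->; rewrite ltxx.
  have xI : 0 <= x <= 1 by rewrite ltW.
  have cpos : 0 < c x 0 by apply: c_gt0 => //; rewrite x0.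
  have [sol U0 V0] := UV (c x 0) (d x 0).
  have uT : U (c x 0) (d x 0) T = c x 0 by apply/eqP; rewrite -subr_eq0 -/(F x 0) Fx.
  have pos : forall t, 0 <= t <= T -> 0 < U (c x 0) (d x 0) t.
    by apply: (pos_of_final sol); rewrite ?U0 ?uT.
  have ub t : 0 <= t <= T -> 0 < U (c x 0) (d x 0) t <= r.
    by move=> tT; rewrite pos//=; apply: le_trans (small x t xI tT); exact: ler_norm.
  have [t [t0 tT E]] := C1_in_mvt sol.1 (lexx 0) T0 (lexx T).
  have vt : V (c x 0) (d x 0) t = 0.
    move: E; rewrite U0 uT subrr subr0 => /esym/eqP; rewrite mulf_eq0 (gt_eqF T0) orbF.
    by move/eqP.
  have tI : 0 <= t <= T by rewrite !ltW.
  have := ivp_v_increases T0 L0 ia lf (ltW e0) sol f_gt0 f_ge0 Hr1 eJ ub tI vt.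
  by rewrite V0 /G subr_gt0.
- by move: corner; rewrite /F /c mulr0 subr0.
- move=> y yI; have [sol U0 V0] := UV (c 1 y) (d 1 y).
  have cpos : 0 < c 1 y by apply: c_gt0 => //; rewrite ltr01 lexx.
  rewrite /F subr_le0 -[leRHS]U0 ltW//; apply: (ivp_steep T0 L0 ia lf fN sol).
    by rewrite U0.
  by rewrite V0 U0 /d /c /M; ring.
(* Outer side: u T > u 0 >= 0 would keep u nonnegative throughout, contradicting
   [initial_data_bound]. *)
- move=> x xI; have [sol U0 V0] := UV (c x 1) (d x 1).
  rewrite /F subr_le0 leNgt; apply/negP => uT.
  have cx := c_ge0 x 1 xI oI.
  have uT0 : 0 < U (c x 1) (d x 1) T by lra.
  have pos : forall t, 0 <= t <= T -> 0 <= U (c x 1) (d x 1) t.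
    move=> t /andP[]; rewrite le_eqVlt => /predU1P[<-|t0] tT; first by rewrite U0.
    apply/ltW/(ivp_u_pos T0 L0 ia lf fN sol); rewrite ?U0 ?V0 ?t0//.
    exact: cd.
  have := HC _ _ sol pos; rewrite U0 V0 => h.
  have E : rho1 = d x 1 + (1 + M) * c x 1 by rewrite /d /c /rho; ring.
  have h1 : (1 + M) * (`|c x 1| + `|d x 1|) <= (1 + M) * C by rewrite ler_wpM2l//; lra.
  have h2 : (1 + M) * c x 1 <= (1 + M) * `|c x 1| by rewrite ler_wpM2l ?ler_norm//; lra.
  have h3 : 0 <= M * `|d x 1| by rewrite mulr_ge0//; lra.
  have := ler_norm (d x 1); rewrite /rho1 in E; lra.
have [sol U0 V0] := UV (c x y) (d x y).
(* A zero on the side x = 0 is impossible because G < 0 there whenever F <= 0. This rules out the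
   trivial solution. *)
have x0 : 0 < x.
  move/andP : (xI) => [+ _]; rewrite le_eqVlt => /predU1P[E|//].
  rewrite -E in Fxy Gxy; have := left y yI; rewrite Fxy Gxy => /(_ (lexx 0)).
  by rewrite ltxx.
have cpos : 0 < c x y by apply: c_gt0 => //; rewrite x0; case/andP : xI.
have uT : U (c x y) (d x y) T = c x y by apply/eqP; rewrite -subr_eq0 -/(F x y) Fxy.
have vT : V (c x y) (d x y) T = d x y by apply/eqP; rewrite -subr_eq0 -/(G x y) Gxy.
exists (U (c x y)  (d x y)), (V (c x y) (d x y)); rewrite U0 V0; split => //.
by apply: (pos_of_final sol); rewrite ?U0 ?uT.
Qed.

End Existence.

(** * Reduction to a Borel weight and a Lipschitz nonlinearity *)

Section BorelVersion.
Context {R : realType}.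
Notation mu := (@lebesgue_measure R).
Notation cmu := (@completed_lebesgue_measure R).
Notation outer := ((@wlength R idfun)^*%mu).
Notation cT := (caratheodory_type outer).

Lemma completed_negligible (N : set R) : mu.-negligible N -> cmu.-negligible N.
Proof.
move=> [A [mA A0 NA]]; exists A; split => //.
exact: sub_caratheodory.
Qed.

Lemma completed_measurable_split (A : set R) : outer.-cara.-measurable A ->
  exists X M : set R, [/\ measurable X, measurable M, mu M = 0%E, X `<=` A & A `<=` X `|` M].
Proof.
rewrite -completed_caratheodory_measurable g_sigma_completed_algebra_genE.
move=> [X mX [N [M [mM M0 NM]] <-]]; exists X, M; split => //.
by move=> x [|/NM]; [left|right].
Qed.

Lemma negligible_completed (N : set R) : cmu.-negligible N -> mu.-negligible N.
Proof.
move=> [A [mA A0 NA]].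
have [X [M [mX mM M0 XA AX]]] := completed_measurable_split mA.
have NXM : N `<=` X `|` M by move=> x /NA /AX.
apply: (@negligibleS _ _ _ mu _ _ NXM); apply: negligibleU; last by exists M; split.
apply/negligibleP => //; apply/eqP; rewrite -measure_le0 -A0.
apply: (@le_measure _ _ _ cmu); rewrite ?inE//.
exact: sub_caratheodory.
Qed.

(** On Borel sets [mu] is the image of [cmu] under the identity, so integrals of Borel functions
    transfer by the pushforward formula. *)
Lemma measurable_id_completed :
  measurable_fun [set: cT] (fun x : cT => (x : measurableTypeR R)).
Proof.
by move=> _ Y mY; rewrite setTI; exact: sub_caratheodory.
Qed.

Lemma completed_integrable (h : R -> R) : measurable_fun [set: measurableTypeR R] h ->
  cmu.-integrable [set: cT] (EFin \o h) -> lebesgue_integrable h.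
Proof.
move=> mh ih.
have mh' := proj2 (measurable_EFinP _ _) mh.
have := integrable_pushforward measurable_id_completed (mu := cmu) mh' (D := setT).
move=> /(_ ih measurableT)/integrableP[m1 l1]; exact/integrableP.
Qed.

Lemma completed_integral (h : R -> R) (D : set R) :
  measurable_fun [set: measurableTypeR R] h -> measurable D ->
  cmu.-integrable [set: cT] (EFin \o h) ->
  (\int[cmu]_(x in D) (h x)%:E = \int[mu]_(x in D) (h x)%:E)%E.
Proof.
move=> mh mD ih.
have mh' := proj2 (measurable_EFinP _ _) mh.
have ihD : cmu.-integrable (D : set cT) (EFin \o h).
  by apply: integrableS ih => //; exact: sub_caratheodory.
exact/esym/(integral_pushforward measurable_id_completed mh' ihD mD).
Qed.

Lemma negligible_bigcup_countable (I : countType) (M : I -> set R) :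
  (forall i, mu.-negligible (M i)) -> mu.-negligible (\bigcup_i M i).
Proof.
move=> negM; pose F n := if unpickle n is Some i then M i else set0.
have MF : \bigcup_i M i `<=` \bigcup_n F n.
  by move=> x [i _ Mx]; exists (pickle i) => //; rewrite /F pickleK.
apply: (@negligibleS _ _ _ mu _ _ MF); apply: negligible_bigcup => n; rewrite /F.
by case: unpickle => //; exact: negligible_set0.
Qed.

(* Every level set {q < b} with q rational is a Borel set up to a null set;
   off the union of these null sets, b is Borel. *)
Lemma borel_off_null (b : R -> R) : measurable_fun [set: cT] b ->
  exists N : set R, [/\ measurable N, mu N = 0%E &
    measurable_fun [set: measurableTypeR R] (fun x => b x * \1_(~` N) x)].
Proof.
move=> mb.
have H (q : rat) : {XM : set R * set R | [/\ measurable XM.1, measurable XM.2,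
    mu XM.2 = 0%E, XM.1 `<=` [set x | ratr q < b x] & [set x | ratr q < b x] `<=` XM.1 `|` XM.2]}.
  apply: cid; have mA : outer.-cara.-measurable [set x | ratr q < b x].
    have := mb measurableT _ (measurable_itv `]ratr q, +oo[).
    rewrite setTI; congr (_ _); apply/seteqP.
    by split => x /=; rewrite in_itv /= andbT.
  by have [X [M ?]] := completed_measurable_split mA; exists (X, M).
pose X q := (sval (H q)).1; pose M q := (sval (H q)).2.
have XMP q : [/\ measurable (X q), measurable (M q),
    mu (M q) = 0%E, X q `<=` [set x | ratr q < b x] & [set x | ratr q < b x] `<=` X q `|` M q].
  by rewrite /X /M; case: (H q).
pose N := \bigcup_q M q.
have mN : measurable N by apply: bigcupT_measurable_rat => q; case: (XMP q).
have MN q : M q `<=` N by move=> x Mx; exists q.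
exists N; split => //.
  apply/negligibleP => //; apply: negligible_bigcup_countable => q.
  by apply/negligibleP; case: (XMP q).
have in0 x : N x -> \1_(~` N) x = 0 :> R.
  by move=> Nx; rewrite indicE memNset//= => /(_ Nx).
have in1 x : ~ N x -> \1_(~` N) x = 1 :> R by move=> Nx; rewrite indicE mem_set.
move=> mT; apply: (measurability _ (RGenOInfty.measurableE R)) => //.
move=> _ [_ [r ->] <-]; rewrite setTI.
(* Off N, b x > r means ratr q < b x for some rational q >= r. On N the modified function is 0, so N
   contributes exactly when r < 0. *)
have -> : (fun x => b x * \1_(~` N) x) @^-1` `]r, +oo[ =
    (\bigcup_(q in [set: rat]) (if r <= ratr q then X q `&` ~` N else set0)) `|`
    (if r < 0 then N else set0).
  apply/seteqP; split => x /=; rewrite ?in_itv /= andbT.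
    have [Nx|Nx] := pselect (N x).
      by rewrite in0// mulr0 => r0; right; rewrite r0.
    rewrite in1// mulr1 => rb; left.
    have [q] := rat_in_itvoo rb; rewrite in_itv /= => /andP[rq qb].
    exists q => //; rewrite ltW//; split => //.
    have [_ _ _ _ /(_ x qb)[//|/MN]] := XMP q; by [].
  move=> [[q _]|].
    case: ifP => // rq [Xx Nx]; rewrite in1// mulr1.
    by apply: le_lt_trans rq _; have [_ _ _ + _] := XMP q; apply.
  by case: ifP => // r0 Nx; rewrite in0// mulr0.
apply: measurableU; last by case: ifP.
apply: bigcupT_measurable_rat => q; case: ifP => // _.
by apply: measurableI; [case: (XMP q)|exact: measurableC].
Qed.

(** [a] is set to 0 outside [0, T] and on a null set. The pointwise alternative [a1 x = a x] or
    [a1 x = 0] is kept because the sign conditions on the J_i are needed at every point, not only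
    almost everywhere. *)
Lemma borel_version (T : R) (a : R -> R) : 0 < T ->
  cmu.-integrable (`[0, T]%classic : set cT) (fun x => (a x)%:E) ->
  exists a1 : R -> R, [/\ lebesgue_integrable a1, forall x, ~~ (0 <= x <= T) -> a1 x = 0,
    forall x, a1 x = a x \/ a1 x = 0,
    {ae mu, forall x, 0 <= x <= T -> a1 x = a x} &
    (\int[cmu]_(x in `[0%R, T]) (a x)%:E)%E = (primitive a1 T - primitive a1 0)%:E].
Proof.
move=> T0 ia.
pose D : set R := `[0, T]%classic.
have mD : measurable D by exact: measurable_itv.
have mDc : outer.-cara.-measurable D by exact: sub_caratheodory.
pose b := a \_ D.
have ib : cmu.-integrable [set: cT] (EFin \o b).
  have := proj1 (integrable_restrict cmu mDc (E := [set: cT]) measurableT (fun x => (a x)%:E)).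
  rewrite setTI => /(_ ia); rewrite restrict_EFin; exact.
have mb : measurable_fun [set: cT] b by exact/measurable_EFinP/(measurable_int cmu).
have [N [mN N0 mbN]] := borel_off_null mb.
pose a1 x := b x * \1_(~` N) x.
have a1E x : ~ N x -> a1 x = b x.
  by move=> Nx; rewrite /a1 indicE mem_set// mulr1.
have a10 x : N x -> a1 x = 0.
  by move=> Nx; rewrite /a1 indicE memNset ?mulr0//= => /(_ Nx).
have ia1c : cmu.-integrable [set: cT] (EFin \o a1).
  have ma1 : measurable_fun [set: cT] (EFin \o a1).
    by apply/measurable_EFinP; exact: measurableT_comp mbN measurable_id_completed.
  have leab x : [set: cT] x -> (`|(EFin \o a1) x| <= `|(EFin \o b) x|)%E.
    move=> _ /=; rewrite lee_fin /a1 normrM ler_piMr//.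
    by rewrite indicE ger0_norm// lern1 leq_b1.
  exact: (le_integrable measurableT ma1 leab ib).
have ia1 := completed_integrable mbN ia1c.
have bE x : D x -> b x = a x by move=> Dx; rewrite /b patchE mem_set.
have b0 x : ~ D x -> b x = 0 by move=> Dx; rewrite /b patchE memNset.
have DE x : D x <-> 0 <= x <= T by rewrite /D /= in_itv.
exists a1; split => //.
- by move=> x xT; rewrite /a1 b0 ?mul0r// => /DE xT'; rewrite xT' in xT.
- move=> x; have [Nx|Nx] := pselect (N x); first by right; exact: a10.
  rewrite a1E//; have [Dx|Dx] := pselect (D x); first by left; exact: bE.
  by right; exact: b0.
- exists N; split => // x /= H; apply: contrapT => Nx; apply: H => /DE Dx.
  by rewrite a1E// bE.
have -> : (\int[cmu]_(x in `[0%R, T]) (a x)%:E = \int[cmu]_(x in `[0%R, T]) (a1 x)%:E)%E.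
  have ma : measurable_fun (D : set cT) (fun x => (a x)%:E) := measurable_int cmu ia.
  have ma1 : measurable_fun (D : set cT) (fun x => (a1 x)%:E).
    by apply: (measurable_int cmu); apply: integrableS ia1c.
  apply: (@ae_eq_integral _ _ _ cmu D (fun x => (a1 x)%:E) (fun x => (a x)%:E) mDc ma ma1).
  exists N; split; [exact: sub_caratheodory|exact: N0|].
  move=> x /= H; apply: contrapT => Nx; apply: H => Dx.
  by rewrite a1E// bE.
rewrite completed_integral//.
rewrite primitiveE ?ltW// -integral_itv_obnd_cbnd.
  rewrite /Rintegral fineK//; apply: integrable_fin_num => //.
  exact: lebesgue_integrableS.
by apply: (measurable_int mu); exact: lebesgue_integrableS.
Qed.

End BorelVersion.

(** * Slope at infinity and truncation of the nonlinearity *)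

Section Nonlinearity.
Context {R : realType}.
Implicit Types (g : R -> R).

(** The liminf is a supremum of infima over neighbourhoods of +oo, so one of these infima exceeds
    every [lam i]. It serves as mu, and it is finite even when the liminf is +oo, being bounded by
    the quotient at a single point. *)
Lemma limf_einf_slope (n : nat) (lam : 'I_n -> R) (i0 : 'I_n) g :
  (\big[Order.max/-oo]_(i < n) (lam i)%:E
     < limf_einf (fun s : R => (g s / s)%:E) (pinfty_nbhs R))%E ->
  exists mu s0 : R, [/\ forall i, lam i < mu, 0 < s0 & forall s, s0 <= s -> mu * s <= g s].
Proof.
rewrite limf_einfE => /ereal_sup_gt[_ [V [M [_ MV]] <-]].
set I := ereal_inf _ => maxI.
have lamI i : ((lam i)%:E < I)%E.
  by apply: le_lt_trans maxI; exact: (le_bigmax _ (fun i => (lam i)%:E)).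
have Ile s : V s -> (I <= (g s / s)%:E)%E.
  by move=> Vs; apply: ereal_inf_lbound; exists s.
pose s0 := Num.max M 0 + 1.
have sV s : s0 <= s -> V s.
  by move=> s0s; apply: MV; apply: lt_le_trans s0s; rewrite /s0 ltr_pwDr// le_max lexx.
have s0_gt0 : 0 < s0 by rewrite /s0 ltr_pwDr// le_max lexx orbT.
case: I lamI Ile {maxI} => [mu| |] lamI Ile.
- exists mu, s0; split => // s s0s.
  by have := Ile s (sV s s0s); rewrite lee_fin ler_pdivlMr//; lra.
- by have := Ile s0 (sV s0 (lexx _)); rewrite leye_eq.
- by have := lamI i0; rewrite ltNge leNye.
Qed.

(** The continuation beyond R1 has slope g R1 / R1 >= mu because R1 >= s0, so the lower bound does
    not depend on R1. The constant |mu| s0 covers s < s0, where only f >= 0 is known. *)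
Lemma truncation g g' (mu s0 R1 : R) : C1_in `[0, +oo[ g g' -> g 0 = 0 ->
  (forall s, 0 < s -> 0 < g s) -> g s / s @[s --> 0^'+] --> 0 ->
  0 < s0 -> (forall s, s0 <= s -> mu * s <= g s) -> s0 <= R1 ->
  exists f L, [/\ [/\ 0 < L, lipschitzian f L & forall s, s <= 0 -> f s = 0],
    forall s, 0 < s -> 0 < f s,
    (forall e, 0 < e -> exists2 r, 0 < r & forall s t, 0 <= s <= r -> 0 <= t <= r ->
       `|f s - f t| <= e * `|s - t|),
    forall s, 0 <= s <= R1 -> f s = g s &
    forall s, 0 <= s -> mu * s - `|mu| * s0 <= f s].
Proof.
move=> C1 g0 gpos glim s00 gs s0R1.
have R10 : 0 < R1 by lra.
have C1r r : C1_in `[0, r] g g'.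
  by apply: C1_inS C1 => x /=; rewrite !in_itv /= andbT => /andP[].
have [L L0 HL] := within_continuous_bounded (ltW R10) (C1r R1).2.
have glip := C1_in_lip (C1r R1) HL.
(* Beyond R1 the graph of f is the line through the origin and (R1, g R1). *)
pose k := g R1 / R1.
have k0 : 0 < k by rewrite divr_gt0// gpos.
pose f s := g (clamp 0 R1 s) + k * Num.max 0 (s - R1).
have cl s : 0 <= clamp 0 R1 s <= R1 by exact/clamp_itv/ltW.
have fE s : 0 <= s <= R1 -> f s = g s.
  move=> /andP[s1 s2]; rewrite /f clampE ?s1// max_l ?mulr0 ?addr0//; lra.
have fN s : s <= 0 -> f s = 0.
  move=> sN; rewrite /f max_l ?mulr0 ?addr0; last lra.
  by rewrite /clamp min_l ?max_l//; lra.
have fB s : R1 <= s -> f s = k * s.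
  move=> sR; rewrite /f /clamp min_r// max_r; last lra.
  rewrite max_r; last lra.
  by rewrite /k; field; rewrite gt_eqF.
(* The limit of g s / s identifies g' 0 as 0; continuity of g' then makes the Lipschitz constant of
   f arbitrarily small near 0. *)
have der0 : g' 0 = 0.
  apply/normr0_eq0/eqP; rewrite eq_le normr_ge0 andbT; apply/ler_addgt0Pr => e e0.
  have e2 : 0 < e / 2 by rewrite divr_gt0.
  have I0 : `[0, +oo[%classic (0 : R) by rewrite /= in_itv /= lexx.
  have [r r0 Hr] := proj1 (has_deriv_inE _ _ _ _) (C1.1 0 I0) _ e2.
  move/cvgrPdist_le : glim => /(_ _ e2); rewrite near_withinE => /nbhs_ballP[q /= q0 Hq].
  pose x := Num.min r q / 2.
  have m0 : 0 < Num.min r q by rewrite lt_min r0.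
  have x0 : 0 < x by rewrite divr_gt0.
  have mr : Num.min r q <= r by rewrite ge_min lexx.
  have mq : Num.min r q <= q by rewrite ge_min lexx orbT.
  have xr : x < r by rewrite /x; lra.
  have xq : x < q by rewrite /x; lra.
  have h1 : `|g x - g' 0 * x| <= e / 2 * x.
    have := Hr x; rewrite g0 !subr0 (gtr0_norm x0); apply => //.
    by rewrite /= in_itv /= ltW.
  have h2 : `|g x| <= e / 2 * x.
    have := Hq x; rewrite /ball /= !sub0r !normrN => /(_ _ x0).
    by rewrite (gtr0_norm x0) normrM normfV (gtr0_norm x0) ler_pdivrMr//; apply.
  have h3 : `|g' 0 * x| <= e * x.
    have -> : g' 0 * x = g x - (g x - g' 0 * x) by ring.
    by rewrite (le_trans (ler_normB _ _))//; lra.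
  by rewrite add0r; move: h3; rewrite normrM (gtr0_norm x0) ler_pM2r.
exists f, (L + k); split => //.
- split => //; first exact: addr_gt0.
  move=> s t; have h1 := clamp_lip 0 R1 s t.
  have h2 := glip _ _ (cl s) (cl t).
  have h3 : `|Num.max 0 (s - R1) - Num.max 0 (t - R1)| <= `|s - t|.
    by apply: le_trans (max_lip _ _ _) _; rewrite opprB addrA subrK.
  have -> : f s - f t = (g (clamp 0 R1 s) - g (clamp 0 R1 t)) +
    k * (Num.max 0 (s - R1) - Num.max 0 (t - R1)) by rewrite /f; ring.
  rewrite (le_trans (ler_normD _ _))// mulrDl lerD//.
    by apply: (le_trans h2); rewrite ler_pM2l.
  by rewrite normrM (gtr0_norm k0) ler_pM2l.
- move=> s spos; have [sR|/ltW Rs] := leP s R1; first by rewrite fE ?gpos// ltW.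
  by rewrite fB// mulr_gt0.
- move=> e e0.
  have [r r0 Hr] : exists2 r, 0 < r & forall x, 0 <= x -> x < r -> `|g' x| <= e.
    have I0 : `[0, R1]%classic (0 : R) by rewrite /= in_itv /= lexx ltW.
    have [r r0 Hr] := proj1 (within_continuousE _ _) (C1r R1).2 0 I0 _ e0.
    exists (Num.min r R1); first by rewrite lt_min r0.
    move=> x x0; rewrite lt_min => /andP[xr xR].
    have := Hr x; rewrite der0 !subr0 (ger0_norm x0) => H; apply/ltW/H => //.
    by rewrite /= in_itv /= x0 ltW.
  pose q := Num.min (r / 2) R1.
  have qr : q <= r / 2 by rewrite ge_min lexx.
  have qR : q <= R1 by rewrite ge_min lexx orbT.
  exists q; first by rewrite lt_min R10 divr_gt0.
  move=> s t sq tq; rewrite !fE; [|lra|lra].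
  apply: (C1_in_lip (C1r q)) => // x /andP[x0 xq]; apply: Hr => //; lra.
- move=> s spos.
  have ms : mu * s <= `|mu| * s by rewrite ler_wpM2r// ler_norm.
  have mu0 := normr_ge0 mu.
  have [ss0|/ltW ss0] := leP s s0.
    apply: (@le_trans _ _ 0).
      have : `|mu| * s <= `|mu| * s0 by rewrite ler_wpM2l.
      lra.
    rewrite fE ?spos//=; last lra.
    by move: spos; rewrite le_eqVlt => /predU1P[<-|/gpos/ltW//]; rewrite g0.
  apply: (@le_trans _ _ (mu * s)).
    by have := mulr_ge0 mu0 (ltW s00); lra.
  have [sR|/ltW Rs] := leP s R1; first by rewrite fE ?spos// gs.
  by rewrite fB// ler_wpM2r// /k ler_pdivlMr// gs.
Qed.

End Nonlinearity.

(** * The intervals J_i and the passage between the two notions of solution *)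

Section SignIntervals.
Context {R : realType}.
Notation mu := (@lebesgue_measure R).
Notation cmu := (@completed_lebesgue_measure R).

(** J may contain or omit either end. As neither is interior to J, both lie in the closure minus the
    interior, where the Dirichlet condition applies. *)
Lemma nondegenerate_interval_ends (J : set R) (T : R) : nondegenerate_interval J ->
  J `<=` `[0, T] -> exists p q, [/\ [/\ 0 <= p, p < q & q <= T],
    J `<=` `[p, q], forall x, p < x < q -> J x &
    [/\ closure J = `[p, q]%classic, ~ J° p & ~ J° q]].
Proof.
move=> [iJ [x [y [Jx Jy xy]]]] JT.
have JT' z : J z -> 0 <= z <= T by move/JT; rewrite /= in_itv.
have hs : has_sup J by split; [exists x|exists T => z /JT'/andP[]].
have hi : has_inf J by split; [exists x|exists 0 => z /JT'/andP[]].
pose p := inf J; pose q := sup J.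
have Jp z : J z -> p <= z by move=> Jz; apply: ge_inf => //; exact: hi.2.
have Jq z : J z -> z <= q by move=> Jz; apply: ub_le_sup => //; exact: hs.2.
have p0 : 0 <= p by apply: lb_le_inf; [exact: hi.1|] => z /JT'/andP[].
have qT : q <= T by apply: ge_sup; [exact: hs.1|] => z /JT'/andP[].
have Jpq : J `<=` `[p, q] by move=> z Jz; rewrite /= in_itv /= Jp// Jq.
have near_p e : 0 < e -> exists2 z, J z & z < p + e by move=> e0; exact: inf_adherent.
have near_q e : 0 < e -> exists2 z, J z & q - e < z by move=> e0; exact: sup_adherent.
have pq : p < q by have := Jp x Jx; have := Jq y Jy; lra.
exists p, q; split => //.
  move=> z /andP[pz zq].
  have [s Js sz] := near_p (z - p) ltac:(lra).
  have [t Jt zt] := near_q (q - z) ltac:(lra).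
  by apply: (iJ s t) => //; apply/andP; split; lra.
have clE : closure J = `[p, q]%classic.
  apply/seteqP; split.
    have cpq : closed `[p, q] by exact: itv_closed.
    by rewrite [X in _ `<=` X](proj1 (closure_id _) cpq); exact: closureS.
  move=> z; rewrite /= in_itv /= => /andP[pz zq] B /nbhs_ballP[e /= e0 Be].
  have [zx|xz] := leP z x.
    have [s Js se] := near_p _ e0.
    have [sz|zs] := leP s z.
      exists z; split; last by apply: Be; exact: ballxx.
      by apply: (iJ s x) => //; rewrite sz zx.
    exists s; split => //; apply: Be; rewrite /ball /= distrC gtr0_norm; lra.
  have [s Js se] := near_q _ e0.
  have [sz|zs] := leP z s.
    exists z; split; last by apply: Be; exact: ballxx.
    by apply: (iJ x s) => //; rewrite sz ltW.
  exists s; split => //; apply: Be; rewrite /ball /= gtr0_norm; lra.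
split => //.
- move=> /nbhs_ballP[e /= e0 He].
  have : J (p - e / 2) by apply: He; rewrite /ball /= gtr0_norm; lra.
  by move/Jp; lra.
- move=> /nbhs_ballP[e /= e0 He].
  have : J (q + e / 2) by apply: He; rewrite /ball /= distrC gtr0_norm; lra.
  by move/Jq; lra.
Qed.

Lemma dirichlet_ac (a a1 : R -> R) (J : set R) (T p q lam : R) : 0 <= p -> q <= T ->
  closure J = `[p, q]%classic -> ~ J° p -> ~ J° q -> p < q ->
  {ae mu, forall x, 0 <= x <= T -> a1 x = a x} -> dirichlet_eigenvalue a J lam ->
  exists phi phi' x0, [/\ C1_in `[p, q] phi phi',
    ac_primitive p q phi' (fun x => - (lam * a1 x * phi x)),
    phi p = 0 /\ phi q = 0, p <= x0 <= q & phi x0 != 0].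
Proof.
move=> p0 qT clJ Jp Jq pq aa1 [phi [phi' [[C1 ac dphi] bd [x0 x0J px0]]]].
rewrite clJ in C1 ac x0J.
exists phi, phi', x0; split => //.
- split => //.
  have H : {ae mu, forall x, x \in `]p, q[ -> derivable phi' x 1 /\ derive1 phi' x + lam * a x * phi x = 0}.
    apply: negligibleS (negligible_completed dphi) => x /= Hx Hc; apply: Hx => xpq.
    apply: Hc; rewrite clJ /=; move: xpq; rewrite !in_itv /= => /andP[? ?].
    by rewrite !ltW.
  apply: lebesgue_ae2 H aa1 => x Hx ax xpq.
  have [dx E] := Hx xpq; rewrite ax; last by move: xpq; rewrite in_itv /= => /andP[]; lra.
  have -> : - (lam * a x * phi x) = derive1 phi' x by lra.
  by rewrite derive1E; exact: DeriveDef.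
- by split; apply: bd; split => //; rewrite clJ /= in_itv /= lexx ltW.
Qed.

Lemma ivp_solves (T : R) (a a1 f g u v : R -> R) :
  {ae mu, forall x, 0 <= x <= T -> a1 x = a x} ->
  (forall x, 0 <= x <= T -> f (u x) = g (u x)) ->
  ivp_sol a1 f 0 T u v -> solves `[0, T] (fun x s => a x * g s) u v.
Proof.
move=> aa1 fg [C1 [acv dv]]; split => //.
apply: completed_negligible.
(* The working notion says nothing about the equation at 0 and T, so these two points are discarded
   as null sets. *)
have H0 (z : R) : {ae mu, forall x, x <> z}.
  exists [set z]; split => //; first exact: lebesgue_measure_set1.
  by move=> x /= H; apply: contrapT => xz; exact: H.
have H := lebesgue_ae2 (fun x => @conj (x <> 0) (x <> T)) (H0 0) (H0 T).
have H' : {ae mu, forall x, 0 <= x <= T ->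
    derivable v x 1 /\ derive1 v x + a x * g (u x) = 0}.
  apply: (lebesgue_ae2 _ H (lebesgue_ae2 (fun x => @conj _ _) aa1 dv)).
  move=> x [x0 xT] [ax dx] x0T.
  have xi : x \in `]0, T[.
    by rewrite in_itv /= !lt_neqAle; move/andP : x0T => [-> ->]; rewrite !andbT;
      apply/andP; split; apply/eqP => // E; apply: x0.
  have [d E] := dx xi; split => //; rewrite derive1E E ax// fg//; ring.
apply: negligibleS H' => x /= Hx Hc; apply: Hx; rewrite in_itv /=; exact: Hc.
Qed.

End SignIntervals.

Unset Implicit Arguments.

Theorem theorem1p2 (R : realType) (T : R) (hT : 0 < T) (a : R -> R)
  (ha : (@completed_lebesgue_measure R).-integrable `[0, T]
          (fun x => (a x)%:E))
  (k : nat) (J : 'I_k -> set R)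
  (hJ : forall i, nondegenerate_interval (J i))
  (hJdisj : trivIset [set: 'I_k] J)
  (hJpos : [set x | 0 <= x <= T /\ 0 < a x] = \bigcup_(i in [set: 'I_k]) J i)
  (hJ0 : \bigcup_(i in [set: 'I_k]) J i !=set0)
  (g g' : R -> R)
  (hg_ge0 : forall s : R, 0 <= s -> 0 <= g s)
  (hgC1 : C1_in `[0, +oo[ g g')
  (hg0 : g 0 = 0)
  (hg_gt0 : forall s : R, 0 < s -> 0 < g s)
  (hg_at0 : g s / s @[s --> 0^'+] --> 0)
  (lam : 'I_k -> R)
  (hlam : forall i, first_eigenvalue a (J i) (lam i))
  (hg_infty : (\big[Order.max/-oo]_(i < k) (lam i)%:E
               < limf_einf (fun s : R => (g s / s)%:E) (pinfty_nbhs R))%E)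
  (ha_neg : (\int[@completed_lebesgue_measure R]_(x in `[0%R, T]) (a x)%:E
             < 0)%E)
  (b : boundary_type) :
  exists u : R -> R, positive_solution b T a g u.
Proof.
have [a1 [ia1 a1_out a1E aa1 inta]] := borel_version hT ha.
rewrite inta lte_fin in ha_neg.
have [x0 [i0 _ _]] := hJ0.
have [mu [s0 [lam_mu s00 gmu]]] := limf_einf_slope i0 hg_infty.
have Jpos i x : J i x -> [/\ 0 <= x, x <= T & 0 < a x].
  move=> Jx; have : (\bigcup_(i in [set: 'I_k]) J i) x by exists i.
  by rewrite -hJpos => -[/andP[? ?] ?].
have JT i : J i `<=` `[0, T] by move=> x /Jpos[? ? _]; apply/andP.
have [p [q pq]] : exists p q : 'I_k -> R, forall i, [/\ [/\ 0 <= p i, p i < q i & q i <= T],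
    J i `<=` `[p i, q i], forall x, p i < x < q i -> J i x &
    [/\ closure (J i) = `[p i, q i]%classic, ~ (J i)° (p i) & ~ (J i)° (q i)]].
  have H i := cid (nondegenerate_interval_ends (hJ i) (JT i)).
  by exists (fun i => sval (H i)), (fun i => sval (cid (svalP (H i)))) => i;
    exact: (svalP (cid (svalP (H i)))).
pose C := `|mu| * s0.
have bnd i : exists M, forall f u v, (forall t, 0 <= t -> mu * t - C <= f t) ->
    (forall t, 0 <= f t) -> ivp_sol a1 f (p i) (q i) u v ->
    (forall x, p i <= x <= q i -> 0 <= u x) -> forall x, p i <= x <= q i -> u x <= M.
  have [[pi0 piqi qiT] _ Jin [cl np nq]] := pq i.
  have [phi [phi' [x1 [C1 acphi [phip phiq] x1I phix1]]]] :=
    dirichlet_ac pi0 qiT cl np nq piqi aa1 (hlam i).1.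
  have a1_ge0 x : p i < x < q i -> 0 <= a1 x.
    by move=> /Jin/Jpos[_ _ ax]; case: (a1E x) => -> //; exact: ltW.
  have a1_gt0 : {ae @lebesgue_measure R, forall x, x \in `]p i, q i[ -> 0 < a1 x}.
    apply: lebesgue_aeS aa1 => x H; rewrite in_itv /= => /Jin/Jpos[x0' xT ax].
    by rewrite H ?x0'.
  exact: (nodal_bound C piqi ia1 (lam_mu i) a1_ge0 a1_gt0 C1 acphi phip phiq x1I phix1).
(* These bounds are fixed before f exists, so the truncation level R1 can be chosen above all of
   them. *)
pose M i := sval (cid (bnd i)).
pose R0 := \sum_(i < k) `|M i|.
have MR0 i : M i <= R0.
  by rewrite /R0 (bigD1 i)//= (le_trans (ler_norm _))// lerDl sumr_ge0.
pose R1 := Num.max s0 R0.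
have s0R1 : s0 <= R1 by rewrite le_max lexx.
have [f [L [[L0 lf fN] fpos fsmall fg fC]]] :=
  truncation hgC1 hg0 hg_gt0 hg_at0 s00 gmu s0R1.
have f_ge0 s : 0 <= f s by have [/fN ->|/fpos/ltW] := leP s 0.
have uM i u v : ivp_sol a1 f 0 T u v -> (forall x, 0 <= x <= T -> 0 <= u x) ->
    forall x, p i <= x <= q i -> u x <= M i.
  move=> sol u0; have [[pi0 _ qiT] _ _ _] := pq i.
  apply: (svalP (cid (bnd i)) f u v fC f_ge0 (ivp_solS pi0 qiT sol)).
  by move=> x xI; apply: u0; lra.
have [u [v [sol upos bc]]] : exists u v, [/\ ivp_sol a1 f 0 T u v,
    forall x, 0 <= x <= T -> 0 < u x & boundary_op b T u v = (0, 0)].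
  have [[pi0 piqi qiT] _ _ _] := pq i0.
  case: b.
    have [u [v [sol v0 vT upos]]] := neumann_exists hT L0 ia1 a1_out ha_neg lf fN
      fpos fsmall pi0 piqi qiT (uM i0).
    by exists u, v; split => //; rewrite /boundary_op v0 vT.
  have [u [v [sol uT vT upos]]] := periodic_exists hT L0 ia1 a1_out ha_neg lf fN
    fpos fsmall pi0 piqi qiT (uM i0).
  by exists u, v; split => //; rewrite /boundary_op uT vT !subrr.
have ule i x : p i <= x <= q i -> u x <= R0.
  move=> xI; apply: le_trans (MR0 i); apply: (uM i u v sol) => // y yT.
  exact/ltW/upos.
have uR0 x : 0 <= x <= T -> u x <= R0.
  (* The bound on the J_i spreads to [0, T] by the maximum principle. With u <= R0 <= R1 everywhere,
     f and g agree along u. *)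
  have [[pi0 piqi qiT] _ _ _] := pq i0.
  apply: (max_principle sol f_ge0 _ (y := p i0)).
  - move=> y yT ay; have ay' : 0 < a y.
      by case: (a1E y) => E; rewrite E ?ltxx in ay.
    have : [set x | 0 <= x <= T /\ 0 < a x] y by [].
    rewrite hJpos => -[i _ Jy]; apply: (ule i).
    by have [_ + _ _] := pq i; move/(_ y Jy); rewrite /= in_itv.
  - by lra.
  - by apply: (ule i0); rewrite lexx ltW.
  move: bc; rewrite /boundary_op; case: b => -[h1 h2]; first by left.
  by right; split; apply/eqP; rewrite -subr_eq0 ?h1 ?h2.
exists u; split => //; exists v; split => //.
apply: ivp_solves aa1 _ sol => x xT; apply: fg.
by rewrite ltW ?upos//= le_max uR0// orbT.
Qed.
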